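(* Let $G$ be a countable discrete amenable group and $\{X_g\}_{g\in G}$ a finite-valued ergodic $G$-process with entropy $h$. Let $\{F_n\}$ be a tempered Følner sequence in $G$ with $|F_n|\ge n$. If $\{W_n\}$ is a filling sequence, then almost surely \[ U^*=\limsup_{k\to\infty}\sup_n-\frac{1}{|F_k|}\log U_{k,n}^{(F,W)}\le h. \]
   Context: Setting: $\Sigma$ finite, $(\Omega,\mathcal F,P)$ a standard probability space with an ergodic measure-preserving free left $G$-action, $x(g)=X(gx)$ for measurable $X:\Omega\to\Sigma$; $h=\lim_k\frac1{|F_k|}H(\{X_g\}_{g\in F_k})$; logs base 2. $[x(E)]=\{x':x'(f)=x(f)\ \forall f\in E\}$. Tempered Følner: $|F_n\triangle gF_n|/|F_n|\to0$ for all $g$ and $|(\bigcup_{k<n}F_k^{-1})F_n|\le C|F_n|$. $x(F_k)$ repeats at $f$ if $fx\in[x(F_k)]$. Define $U_{k,n}^{(F,W)}(x)=\frac{1}{|W_n|}\max\{|E|: 1_G\in E\subseteq W_n,\ \{F_kf\}_{f\in E}\text{ pairwise disjoint},\ x(F_k)\text{ repeats at every }f\in E\}$. Incremental sequence $\{W_{n(i)}f_i\}_{i=1}^I$: $n(1)\ge\dots\ge n(I)$ and $f_i\notin\bigcup_{j<i}W_{n(j)}f_j$. A sequence $\{W_n\}$ of finite sets with $1_G\in W_n$ is filling (with constant $C>0$) if for every incremental sequence $|\bigcup W_{n(i)}f_i|\ge C\sum|W_{n(i)}f_i|$. *)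

(* Defs.v *)
From HB Require Import structures.
From mathcomp Require Import all_boot all_order all_algebra.
From mathcomp Require Import all_classical all_reals all_analysis.
Set Implicit Arguments. Unset Strict Implicit. Unset Printing Implicit Defensive.
Import Order.TTheory GRing.Theory Num.Theory numFieldNormedType.Exports.
Local Open Scope classical_set_scope.
Local Open Scope ring_scope.

Record group_str (G : countType) := GroupStr {
  gmul : G -> G -> G;
  ginv : G -> G;
  gone : G;
  gmulA : forall a b c, gmul a (gmul b c) = gmul (gmul a b) c;
  gmul1 : forall a, gmul gone a = a;
  gmulV : forall a, gmul (ginv a) a = gone }.

Section Defs.
Variables (G : countType) (Gs : group_str G).
Local Notation "a *g b" := (gmul Gs a b) (at level 40, left associativity).

(* Finite subsets of G are represented by duplicate-free sequences. *)
Definition rtrans (A : seq G) (f : G) : seq G := [seq a *g f | a <- A].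
Definition ltrans (g : G) (A : seq G) : seq G := [seq g *g a | a <- A].
Definition symdiff_card (A B : seq G) : nat :=
  (size [seq a <- A | a \notin B] + size [seq b <- B | b \notin A])%N.

Definition folner (R : realType) (F : nat -> seq G) : Prop :=
  (forall n, uniq (F n) /\ (0 < size (F n))%N) /\
  forall g, (fun n => (symdiff_card (F n) (ltrans g (F n)))%:R / (size (F n))%:R : R)
             @ \oo --> 0.

Definition tempered (R : realType) (F : nat -> seq G) : Prop :=
  exists C : R, forall n,
    (size (undup [seq a *g b | a <- flatten [seq map (ginv Gs) (F k) | k <- iota 0 n],
                              b <- F n]))%:R <= C * (size (F n))%:R.

(* Incremental sequence {W_{n(i)} f_i}_{i}: list of pairs (n(i), f_i). *)
Fixpoint incremental_aux (W : nat -> seq G) (prev : seq G) (s : seq (nat * G)) : bool :=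
  match s with
  | [::] => true
  | (n, f) :: s' => (f \notin prev) && incremental_aux W (prev ++ rtrans (W n) f) s'
  end.
Definition incremental (W : nat -> seq G) (s : seq (nat * G)) : bool :=
  sorted geq (map fst s) && incremental_aux W [::] s.

Definition filling_with (R : realType) (W : nat -> seq G) (C : R) : Prop :=
  0 < C /\ (forall n, uniq (W n) /\ gone Gs \in W n) /\
  forall s : seq (nat * G), incremental W s ->
    C * (sumn [seq size (rtrans (W p.1) p.2) | p <- s])%:R
      <= (size (undup (flatten [seq rtrans (W p.1) p.2 | p <- s])))%:R.
Definition filling (R : realType) (W : nat -> seq G) : Prop :=
  exists C : R, filling_with W C.

Variables (d : measure_display) (T : measurableType d) (Sigma : finType).
Variables (act : G -> T -> T) (X : T -> Sigma).

Definition pattern (A : seq G) (x : T) : seq Sigma := [seq X (act a x) | a <- A].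

Definition repeats_at (F : seq G) (x : T) (f : G) : bool :=
  pattern F (act f x) == pattern F x.

Definition valid_E (F W : seq G) (x : T) (E : seq G) : bool :=
  [&& gone Gs \in E, all (fun e => e \in W) E,
      all (fun e1 => all (fun e2 => (e1 == e2) ||
            ~~ has (fun a => a \in rtrans F e2) (rtrans F e1)) E) E
    & all (repeats_at F x) E].

(* U_{k,n}^{(F,W)}(x): subsets E of W_n enumerated as masks of W_n *)
Definition U_kn (R : realType) (F W : nat -> seq G) (k n : nat) (x : T) : R :=
  (\max_(m : (size (W n)).-tuple bool | valid_E (F k) (W n) x (mask m (W n)))
     size (mask m (W n)))%:R / (size (W n))%:R.
End Defs.

Definition log2 (R : realType) (x : R) : R := ln x / ln 2.

Definition joint_entropy (R : realType) (G : countType) d (T : measurableType d)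
  (Sigma : finType) (P : probability T R) (act : G -> T -> T) (X : T -> Sigma)
  (A : seq G) : R :=
  \sum_(w : (size A).-tuple Sigma)
     (let p := fine (P [set x | pattern act X A x = val w]) in
      if p == 0 then 0 else - (p * log2 p)).

Definition standard_borel (R : realType) d (T : measurableType d) : Prop :=
  exists f : T -> R, injective f /\ measurable_fun setT f /\
    measurable (range f) /\ (forall A, measurable A -> measurable (f @` A)).

(* Main.v *)
(* A point x is bad at scale k when, for some n, its pattern on F_k recurs in
   W_n with density below 2^-(h+eps)|F_k|.  Fix a pattern c and consider the
   bad points with pattern c along an orbit inside a large Folner set.  Greedy
   disjointification costs only a factor |F_k|^2, so these points have density
   at most |F_k|^2 2^-(h+eps)|F_k| in W_n g around each of them, and the
   filling property turns this into the same bound (up to a constant) for the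
   probability of {bad and pattern c}.  Summing over the patterns c that matter
   and applying Borel-Cantelli gives the theorem, provided that almost surely
   x(F_k) eventually lies in a family of about 2^{h|F_k|} patterns.

   That upper half of the Shannon-McMillan theorem is obtained without
   quasi-tilings.  For a fixed window M = F_m, Finner's inequality applied to
   the translates M f, f in F_k (each site of F_k lies in |M| of them, up to a
   boundary of size o(|F_k|)) shows that
     Q(y) = prod_{f in F_k} P[y on M f]^(1/|M|)
   has total mass at most |Sigma|^o(|F_k|), while -log Q(x(F_k)) / |F_k| is at
   most 1/|M| times the ergodic average of -log P[x(M)], which tends to
   H(X_M)/|M|.

   The pointwise ergodic theorem is needed only for bounded functions.  Every
   such function is, up to a bounded error of small mean, a constant plus
   coboundaries; and for functions with values in [0,1] the maximal inequality
   follows from a deterministic greedy covering argument, because translates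
   with small relative overlap still carry a definite share of the function. *)
Require Import Defs.
From HB Require Import structures.
From mathcomp Require Import all_boot all_order all_algebra.
From mathcomp Require Import all_classical all_reals all_analysis.
From mathcomp Require Import measurable_realfun ring lra.
Set Implicit Arguments. Unset Strict Implicit. Unset Printing Implicit Defensive.
Import Order.TTheory GRing.Theory Num.Theory numFieldNormedType.Exports.
Local Open Scope classical_set_scope.
Local Open Scope ring_scope.

(** * Finite subsets of groups *)

Section GroupTheory.
Variables (G : countType) (Gs : group_str G).
Local Notation "a *g b" := (gmul Gs a b) (at level 40, left associativity).
Local Notation "1g" := (gone Gs).
Local Notation inv := (ginv Gs).

Lemma gmulVr a : a *g inv a = 1g.
Proof.
rewrite -[LHS](gmul1 Gs) -{1}(gmulV Gs (inv a)) -gmulA (gmulA Gs (inv a)).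
by rewrite gmulV gmul1 gmulV.
Qed.

Lemma gmulr1 a : a *g 1g = a.
Proof. by rewrite -(gmulV Gs a) gmulA gmulVr gmul1. Qed.

Lemma gmulK a b : a *g b *g inv b = a.
Proof. by rewrite -gmulA gmulVr gmulr1. Qed.

Lemma gmulKV a b : a *g inv b *g b = a.
Proof. by rewrite -gmulA gmulV gmulr1. Qed.

Lemma gmulVK a b : inv a *g (a *g b) = b.
Proof. by rewrite gmulA gmulV gmul1. Qed.

Lemma gmulVKV a b : a *g (inv a *g b) = b.
Proof. by rewrite gmulA gmulVr gmul1. Qed.

Lemma gmulIr b : injective (fun a => a *g b).
Proof. by move=> a a' /(congr1 (fun u => u *g inv b)); rewrite !gmulK. Qed.

Lemma gmulIl a : injective (gmul Gs a).
Proof. by move=> b b' /(congr1 (gmul Gs (inv a))); rewrite !gmulVK. Qed.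

Lemma ginv_inj : injective inv.
Proof.
have invK a : inv (inv a) = a.
  by rewrite -[LHS](gmulKV _ a) gmulV gmul1.
by move=> a b E; rewrite -(invK a) E invK.
Qed.

Lemma mem_rtrans A f x : (x \in rtrans Gs A f) = (x *g inv f \in A).
Proof.
apply/mapP/idP => [[a aA ->]|h]; first by rewrite gmulK.
by exists (x *g inv f); rewrite ?gmulKV.
Qed.

Lemma mem_ltrans A f x : (x \in ltrans Gs f A) = (inv f *g x \in A).
Proof.
apply/mapP/idP => [[a aA ->]|h]; first by rewrite gmulVK.
by exists (inv f *g x); rewrite ?gmulVKV.
Qed.

Lemma rtrans_uniq A f : uniq A -> uniq (rtrans Gs A f).
Proof. by rewrite map_inj_uniq //; exact: gmulIr. Qed.

Lemma ltrans_uniq A f : uniq A -> uniq (ltrans Gs f A).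
Proof. by rewrite map_inj_uniq //; exact: gmulIl. Qed.

(** * Product sets, packings and coverings by translates *)

Definition prodset (K A : seq G) := undup [seq a *g b | a <- K, b <- A].

Lemma mem_prodset K A a b : a \in K -> b \in A -> a *g b \in prodset K A.
Proof. by move=> aK bA; rewrite mem_undup; apply/allpairsP; exists (a, b). Qed.

(** A product [a *g b] that falls outside [A] lies in [a A] minus [A], so the growth of [A] under
    left multiplication by [K] is controlled by its boundaries. *)
Lemma size_prodset K A :
  (size (prodset K A) <= size A + \sum_(a <- K) symdiff_card A (ltrans Gs a A))%N.
Proof.
pose L := A ++ flatten [seq [seq b <- ltrans Gs a A | b \notin A] | a <- K].
apply: (@leq_trans (size L)).
  apply: uniq_leq_size; first exact: undup_uniq.
  move=> x; rewrite mem_undup => /allpairsP[[a b] /= [aK bA ->]].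
  rewrite mem_cat; case: (boolP (a *g b \in A)) => //= nA.
  apply/flatten_mapP; exists a => //.
  by rewrite mem_filter nA /= mem_ltrans gmulVK.
rewrite size_cat leq_add2l size_flatten sumnE /shape !big_map.
by apply: leq_sum => a _; exact: leq_addl.
Qed.

(** The greedy choice starts from [z], so [z] is never discarded; later this keeps the identity in
    [E], as the definition of [U_kn] demands. An element is dropped only when it is related to one
    already kept, which is the last clause. *)
Lemma greedy_packing (T : eqType) (r : rel T) (z : T) (D : seq T) :
  reflexive r -> symmetric r ->
  exists E : seq T, [/\ uniq E, z \in E, {subset E <= z :: D},
    {in E &, forall e1 e2, e1 != e2 -> ~~ r e1 e2} &
    {in z :: D, forall d, exists2 e, e \in E & r d e}].
Proof.
move=> rr rs; elim: D => [|d D [E [uE zE sE pE dE]]].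
  exists [:: z]; split=> //; first by rewrite mem_head.
  - by move=> a b; rewrite !inE => /eqP-> /eqP->; rewrite eqxx.
  - by move=> a; rewrite inE => /eqP->; exists z; rewrite ?mem_head.
have [/hasP[e eE re]|/hasPn nr] := boolP (has (r d) E).
  exists E; split=> //.
    by move=> x /sE; rewrite !inE => /orP[->//|->]; rewrite !orbT.
  move=> x; rewrite !inE => /or3P[/eqP->|/eqP->|xD].
  - by apply: dE; rewrite mem_head.
  - by exists e.
  - by apply: dE; rewrite inE xD orbT.
exists (d :: E); split.
- rewrite /= uE andbT; apply/negP => dE'.
  by have := nr _ dE'; rewrite rr.
- by rewrite inE zE orbT.
- move=> x; rewrite inE => /orP[/eqP->|/sE]; rewrite !inE ?eqxx ?orbT //.
  by move=> /orP[->//|->]; rewrite !orbT.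
- move=> a b; rewrite !inE => /orP[/eqP->|aE] /orP[/eqP->|bE].
  + by rewrite eqxx.
  + by move=> _; exact: nr.
  + by move=> _; rewrite rs; exact: nr.
  + exact: pE.
- move=> x; rewrite !inE => /or3P[/eqP->|/eqP->|xD].
  + by have [|e eE re] := dE z; rewrite ?mem_head //; exists e; rewrite ?inE ?eE ?orbT.
  + by exists d; rewrite ?mem_head.
  + by have [|e eE re] := dE x; rewrite ?inE ?xD ?orbT //; exists e; rewrite ?inE ?eE ?orbT.
Qed.

Definition meets (F : seq G) e1 e2 :=
  has (fun a => a \in rtrans Gs F e2) (rtrans Gs F e1).

Lemma meets_sym F : symmetric (meets F).
Proof.
by move=> a b; apply/hasP/hasP => -[x xa xb]; exists x.
Qed.

Lemma meets_refl F : (0 < size F)%N -> reflexive (meets F).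
Proof.
case: F => // a F _ x; apply/hasP; exists (a *g x); exact: mem_head.
Qed.

(** Any [d] whose translate [F d] meets [F e] has the form [a^-1 b e] with [a], [b] in [F]. Each
    kept [e] therefore accounts for at most [size F ^ 2] elements of [D]. *)
Lemma disjoint_translates (F D : seq G) z : (0 < size F)%N -> z \in D -> uniq D ->
  exists E : seq G, [/\ uniq E, z \in E, {subset E <= D},
    {in E &, forall e1 e2, e1 != e2 -> ~~ meets F e1 e2} &
    (size D <= size E * size F ^ 2)%N].
Proof.
move=> F0 zD uD.
have [E [uE zE sE pE dE]] :=
  greedy_packing z D (meets_refl F0) (@meets_sym F).
exists E; split=> //.
  by move=> x /sE; rewrite inE => /orP[/eqP->|].
pose L := flatten [seq [seq inv a *g (b *g e) | a <- F, b <- F] | e <- E].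
apply: (@leq_trans (size L)).
  apply: uniq_leq_size => // x xD.
  have [|e eE] := dE x; first by rewrite inE xD orbT.
  move=> /hasP[y] /mapP[a aF ->] /mapP[b bF E1].
  apply/flatten_mapP; exists e => //.
  by apply/allpairsP; exists (a, b); split=> //=; rewrite -E1 gmulVK.
rewrite size_flatten sumnE /shape !big_map.
under eq_bigr do rewrite size_allpairs.
by rewrite big_const_seq count_predT iter_addn_0 mulnC expnS expn1.
Qed.

(** Scan [L] and keep a pair exactly when its centre is not yet covered. A kept centre covers itself
    because the identity lies in every window. The list [prev] is general because it is the
    accumulator of [incremental_aux]. *)
Lemma incremental_subcover (W : nat -> seq G) (L : seq (nat * G)) prev :
  (forall n, 1g \in W n) ->
  exists s, [/\ subseq s L, incremental_aux Gs W prev s &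
    {in L, forall p, p.2 \in prev ++ flatten [seq rtrans Gs (W q.1) q.2 | q <- s]}].
Proof.
move=> W1; elim: L prev => [|[n g] L IH] prev.
  by exists [::]; split.
have [gp|gp] := boolP (g \in prev).
  have [s [ss si sc]] := IH prev; exists s; split=> //.
    by apply: (subseq_trans ss); exact: subseq_cons.
  move=> p; rewrite inE => /orP[/eqP-> /=|/sc//].
  by rewrite mem_cat gp.
have [s [ss si sc]] := IH (prev ++ rtrans Gs (W n) g).
exists ((n, g) :: s); split.
- by rewrite /= eqxx.
- by rewrite /= gp si.
- move=> p; rewrite inE => /orP[/eqP-> /=|/sc].
    by rewrite !mem_cat mem_rtrans gmulVr W1 orbT.
  by rewrite /= catA.
Qed.

Section Real.
Variable R : realType.

(** A Vitali-type argument: from the windows centred on [D], extract an incremental sequence that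
    still covers [D]. Its total size is at least [size D / kap] (for positive [kap]), by the
    sparseness of [D] in each window, and at most the size of its union over [C], by filling. *)
Lemma filling_count (W : nat -> seq G) (C kap : R) (D : seq G) (n : G -> nat) :
  filling_with Gs W C -> 0 <= kap -> uniq D ->
  {in D, forall g, (count (fun d => d \in rtrans Gs (W (n g)) g) D)%:R
                   <= kap * (size (W (n g)))%:R} ->
  C * (size D)%:R <=
  kap * (size (undup (flatten [seq rtrans Gs (W (n g)) g | g <- D])))%:R.
Proof.
move=> [C0 [uW fW]] k0 uD hD.
(* Larger indices come first, so every subsequence has the nonincreasing indices required of an
   incremental sequence. *)
pose L := sort (fun p q : nat * G => geq p.1 q.1) [seq (n g, g) | g <- D].
have [s [ss si sc]] := @incremental_subcover W L [::] (fun n => (uW n).2).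
have LD q : q \in L -> q.2 \in D /\ q.1 = n q.2.
  by rewrite mem_sort => /mapP[g gD ->].
have sD q : q \in s -> q.2 \in D /\ q.1 = n q.2 by move=> /(mem_subseq ss)/LD.
have hs : incremental Gs W s.
  rewrite /incremental si andbT.
  have : sorted (fun p q : nat * G => geq p.1 q.1) s.
    apply: (subseq_sorted _ ss); first by move=> a b c /= ba cb; exact: leq_trans cb ba.
    by apply: sort_sorted => a b; exact: leq_total.
  by rewrite sorted_map.
(* Each point of [D] is counted in at least one selected window. *)
have le1 : (size D)%:R <= \sum_(q <- s) kap * (size (W q.1))%:R.
  apply: (@le_trans _ _ (\sum_(q <- s) (count (fun d => d \in rtrans Gs (W q.1) q.2) D)%:R)); last first.
    rewrite !big_seq; apply: ler_sum => q qs.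
    by have [qD ->] := sD q qs; exact: hD.
  rewrite -natr_sum ler_nat.
  under eq_bigr do rewrite -sum1_count big_mkcond.
  rewrite exchange_big -sum1_size !big_seq.
  apply: leq_sum => d dD.
  have /sc : (n d, d) \in L by rewrite mem_sort; apply/mapP; exists d.
  rewrite /= => /flatten_mapP[q qs dq].
  by rewrite (big_rem q) //= dq.
have fs := fW _ hs.
have le2 : \sum_(q <- s) kap * (size (W q.1))%:R =
   kap * (sumn [seq size (rtrans Gs (W p.1) p.2) | p <- s])%:R.
  rewrite -mulr_sumr sumnE big_map natr_sum.
  by under [in RHS]eq_bigr do rewrite size_map.
rewrite le2 in le1.
apply: (@le_trans _ _ (C * (kap * (sumn [seq size (rtrans Gs (W p.1) p.2) | p <- s])%:R))).
  by rewrite ler_pM2l.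
rewrite mulrCA ler_wpM2l //; apply: (le_trans fs).
rewrite ler_nat; apply: uniq_leq_size; first exact: undup_uniq.
move=> x; rewrite !mem_undup => /flatten_mapP[q qs xq].
have [qD qn] := sD q qs.
by apply/flatten_mapP; exists q.2 => //; rewrite -qn.
Qed.

(* A translate is kept when it overlaps the part already covered in less than
   a fraction [lam / 2]; since [f <= 1] there, it brings at least [lam / 2] of
   new mass. *)
Lemma greedy_overlap (F D : seq G) (f : G -> R) (lam : R) :
  (forall g, 0 <= f g <= 1) -> uniq F -> 0 < lam ->
  {in D, forall b, lam * (size F)%:R <= \sum_(g <- rtrans Gs F b) f g} ->
  exists E U : seq G, [/\ uniq U, {subset E <= D},
    U =i flatten [seq rtrans Gs F e | e <- E],
    lam / 2 * (size E * size F)%:R <= \sum_(g <- U) f g &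
    {in D, forall b, lam / 2 * (size F)%:R
             <= (count (fun g => g \in U) (rtrans Gs F b))%:R}].
Proof.
move=> f01 uF l0; elim: D => [|d D IH] hD.
  by exists [::], [::]; split=> //; rewrite big_nil mul0n mulr0.
have [|E [U [uU sE UE eE dE]]] := IH.
  by move=> b bD; apply: hD; rewrite inE bD orbT.
have sE' : {subset E <= d :: D} by move=> x /sE; rewrite inE orbC => ->.
have [le|lt] := leP (lam / 2 * (size F)%:R)
    ((count (fun g => g \in U) (rtrans Gs F d))%:R : R).
  exists E, U; split=> // b; rewrite inE => /orP[/eqP->//|]; exact: dE.
pose N := [seq g <- rtrans Gs F d | g \notin U].
exists (d :: E), (N ++ U); split.
- rewrite cat_uniq uU filter_uniq ?rtrans_uniq //= andbT.
  by apply/hasPn => x xU; rewrite mem_filter /= xU.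
- by move=> x; rewrite inE => /orP[/eqP->|/sE']; rewrite ?mem_head.
- move=> x; rewrite mem_cat mem_filter /= [in RHS]mem_cat UE.
  by case: (x \in flatten _); rewrite ?orbT ?orbF.
- rewrite big_cat /=.
  have h1 := hD d (mem_head _ _).
  have h2 : \sum_(g <- rtrans Gs F d) f g <=
    \sum_(g <- N) f g + (count (fun g => g \in U) (rtrans Gs F d))%:R.
    rewrite (bigID (fun g => g \in U)) /= addrC big_filter lerD //.
    rewrite -sum1_count natr_sum; apply: ler_sum => g _.
    by have /andP[] := f01 g.
  rewrite mulSn natrD mulrDr.
  lra.
- move=> b; rewrite inE => /orP[/eqP->|bD].
    (* The translate of the new centre is now entirely covered, and [f <= 1] gives
       [lam * size F <= size F], so the required half of [lam] is available. *)
    rewrite (_ : count _ _ = size F); last first.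
      rewrite -(size_map (fun a => a *g d)); apply/eqP; rewrite -all_count.
      apply/allP => x xF; rewrite mem_cat mem_filter xF andbT.
      by case: (x \in U).
    have : lam * (size F)%:R <= (size F)%:R.
      apply: (le_trans (hD d (mem_head _ _))).
      rewrite -[in leRHS](size_map (fun a => a *g d)) -sum1_size natr_sum.
      by apply: ler_sum => g _; have /andP[] := f01 g.
    have : 0 <= lam * (size F)%:R by rewrite mulr_ge0 // ltW.
    lra.
  apply: (le_trans (dE b bD)); rewrite ler_nat.
  by apply: sub_count => x xU; rewrite mem_cat xU orbT.
Qed.

(** Count the pairs [(a, b)] with [a *g b] in [U]. For fixed [a] the map [b |-> a *g b] is injective
    into [U], so there are at most [size F * size U] of them. *)
Lemma translate_double_count (F D U : seq G) (mu : R) :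
  uniq D -> uniq U -> (0 < size F)%N ->
  {in D, forall b, mu * (size F)%:R
             <= (count (fun g => g \in U) (rtrans Gs F b))%:R} ->
  mu * (size D)%:R <= (size U)%:R.
Proof.
move=> uD uU F0 hD.
rewrite -(ler_pM2r (x := (size F)%:R)) ?ltr0n //.
apply: (@le_trans _ _ (\sum_(b <- D) (count (fun g => g \in U) (rtrans Gs F b))%:R)).
  have -> : mu * (size D)%:R * (size F)%:R = \sum_(b <- D) mu * (size F)%:R.
    rewrite mulrAC -[in LHS](sum1_size D) natr_sum mulr_sumr.
    by apply: eq_bigr => b _; rewrite mulr1.
  by rewrite !big_seq; apply: ler_sum => b bD; exact: hD.
rewrite -natr_sum -natrM ler_nat.
under eq_bigr do rewrite count_map -sum1_count big_mkcond.
rewrite exchange_big /= mulnC -sum1_size big_distrl /=.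
apply: leq_sum => a _; rewrite mul1n -big_mkcond sum1_count.
rewrite -size_filter -(size_map (gmul Gs a)); apply: uniq_leq_size.
  by rewrite map_inj_uniq ?filter_uniq //; exact: gmulIl.
by move=> x /mapP[b]; rewrite mem_filter => /andP[/= h _] ->.
Qed.

(** Induction on the scale, largest windows first. Greedy selection at scale [N] yields centres [E]
    and a union [U] of mass at least [lam / 2 * size E * size (F N)]. This mass pays for the centres
    of scale [N] and for the smaller windows that hit [U]. The remaining windows avoid [U], so the
    mass found for them by induction adds up with that of [U]. *)
Lemma covering_lemma (F : nat -> seq G) (f : G -> R) (C lam : R) :
  (forall n, uniq (F n) /\ (0 < size (F n))%N) ->
  (forall n,
    (size (undup [seq a *g b | a <- flatten [seq map inv (F k) | k <- iota 0 n],
                              b <- F n]))%:R <= C * (size (F n))%:R) ->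
  (forall g, 0 <= f g <= 1) -> 0 < lam -> 0 <= C ->
  forall N (D : seq G) (k : G -> nat), uniq D ->
  {in D, forall b, (k b < N)%N} ->
  {in D, forall b, lam * (size (F (k b)))%:R <= \sum_(g <- rtrans Gs (F (k b)) b) f g} ->
  exists U, [/\ uniq U, {subset U <= flatten [seq rtrans Gs (F (k b)) b | b <- D]} &
    (size D)%:R <= (2 / lam + C) * (2 / lam) * \sum_(g <- U) f g].
Proof.
move=> uF tF f01 l0 C0; elim=> [|N IH] D k uD kN hD.
  exists [::]; split=> //; case: D kN {uD hD} => [|d D] kN.
    by rewrite big_nil mulr0.
  by have := kN d (mem_head _ _).
pose D1 := [seq b <- D | k b == N].
have [|E [U [uU sE UE eE dE]]] :=
   @greedy_overlap (F N) D1 f lam f01 (uF N).1 l0.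
  by move=> b; rewrite mem_filter => /andP[/eqP <- bD]; exact: hD.
pose hit b := has (fun g => g \in U) (rtrans Gs (F (k b)) b).
pose D2 := [seq b <- D | (k b != N) && ~~ hit b].
pose D3 := [seq b <- D | (k b != N) && hit b].
have [|||U' [uU' sU' bU']] := IH D2 k.
- by rewrite filter_uniq.
- move=> b; rewrite mem_filter => /andP[/andP[kb _] bD].
  by have := kN b bD; rewrite ltnS leq_eqVlt (negbTE kb).
- by move=> b; rewrite mem_filter => /andP[_ bD]; exact: hD.
have sD : size D = (size D1 + (size D3 + size D2))%N.
  rewrite !size_filter -(count_predC (fun b => k b == N)); congr addn.
  rewrite -[in LHS]size_filter -(count_predC hit) !count_filter.
  by congr addn; apply: eq_count => b /=; rewrite andbC.
have dUU' x : x \in U' -> x \notin U.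
  move=> /sU'/flatten_mapP[b]; rewrite mem_filter => /andP[/andP[_ /hasPn h] _].
  exact: h.
exists (U ++ U'); split.
- rewrite cat_uniq uU uU' andbT /=; apply/hasPn => x xU; exact: dUU'.
- move=> x; rewrite mem_cat UE => /orP[/flatten_mapP[e /sE]|/sU'/flatten_mapP[b]].
    rewrite mem_filter => /andP[/eqP kb bD] xe.
    by apply/flatten_mapP; exists e => //; rewrite kb.
  rewrite mem_filter => /andP[_ bD] xb.
  by apply/flatten_mapP; exists b.
have b1 : lam / 2 * (size D1)%:R <= (size U)%:R.
  apply: (@translate_double_count (F N) D1 U) => //; rewrite ?filter_uniq //.
  by have [] := uF N.
have b1' : (size U <= size E * size (F N))%N.
  apply: (@leq_trans (size (flatten [seq rtrans Gs (F N) e | e <- E]))).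
    by apply: uniq_leq_size => // x; rewrite UE.
  rewrite size_flatten sumnE /shape !big_map.
  under eq_bigr do rewrite size_map.
  by rewrite big_const_seq count_predT iter_addn_0 mulnC.
(* If [F (k b) b] meets [F N e] with [k b < N], then [b] lies in [F (k b)^-1 (F N) e]; temperedness
   bounds the number of such [b] for each [e]. *)
have b3 : (size D3)%:R <= C * (size E * size (F N))%:R.
  pose Z := undup [seq a *g b | a <- flatten [seq map inv (F j) | j <- iota 0 N],
                              b <- F N].
  have : (size D3 <= size E * size Z)%N.
    apply: (@leq_trans (size (flatten [seq rtrans Gs Z e | e <- E]))).
      apply: uniq_leq_size; first by rewrite filter_uniq.
      move=> b; rewrite mem_filter => /andP[/andP[kb /hasP[g gb]]].
      rewrite UE => /flatten_mapP[e eE1 /mapP[c cF gc]] bD.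
      apply/flatten_mapP; exists e => //; rewrite mem_rtrans mem_undup.
      move: gb => /mapP[a aF ga].
      apply/allpairsP; exists (inv a, c); split => //=.
        apply/flatten_mapP; exists (k b); last by apply: map_f.
        rewrite mem_iota /= add0n.
        by have := kN b bD; rewrite ltnS leq_eqVlt (negbTE kb).
      by rewrite -[c](gmulK c e) -gc ga gmulA gmulVK.
    rewrite size_flatten sumnE /shape !big_map.
    under eq_bigr do rewrite size_map.
    by rewrite big_const_seq count_predT iter_addn_0 mulnC.
  rewrite -(ler_nat R) => /le_trans; apply.
  rewrite !natrM mulrCA ler_wpM2l //; exact: tF.
rewrite sD big_cat /= mulrDr !natrD addrA lerD //.
rewrite -(ler_nat R) in b1'.
have inv2 : 2 / lam * (lam / 2) = 1.
  by rewrite mulrA divfK ?lt0r_neq0 // divff.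
have b4 : (size D1)%:R <= 2 / lam * (size E * size (F N))%:R.
  have h := le_trans b1 b1'; rewrite -(ler_pM2l (x := 2 / lam)) ?divr_gt0 // in h.
  move: h.
  by rewrite mulrA inv2 mul1r.
apply: (le_trans (lerD b4 b3)); rewrite -mulrDl -mulrA ler_wpM2l //.
  by rewrite addr_ge0 // divr_ge0 // ltW.
by rewrite -(ler_pM2l (x := lam / 2)) ?divr_gt0 // mulrA [lam / 2 * (_ / _)]mulrC inv2 mul1r.
Qed.

Lemma folner_boundary (F : nat -> seq G) (K : seq G) (eta : R) : folner Gs R F ->
  0 < eta -> exists N, forall n, (N <= n)%N ->
  (\sum_(a <- K) symdiff_card (F n) (ltrans Gs a (F n)))%:R <= eta * (size (F n))%:R.
Proof.
move=> [uF hF]; elim: K eta => [|a K IH] eta e0.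
  by exists 0%N => n _; rewrite big_nil mulr_ge0 // ltW.
have e20 : 0 < eta / 2 by rewrite divr_gt0.
have [N1 h1] := IH _ e20.
have /cvgrPdist_le /(_ _ e20)[N2 _ h2] := hF a.
exists (maxn N1 N2) => n; rewrite geq_max => /andP[n1 n2].
rewrite big_cons natrD [eta in leRHS](splitr eta) mulrDl lerD //; last exact: h1.
have /= := h2 n n2; rewrite sub0r normrN => /(le_trans (ler_norm _)).
by rewrite ler_pdivrMr // ltr0n; have [] := uF n.
Qed.

Lemma folner_growth (F : nat -> seq G) (K : seq G) (eta : R) : folner Gs R F ->
  0 < eta -> exists n, (size (prodset K (F n)))%:R <= (1 + eta) * (size (F n))%:R.
Proof.
move=> fF e0; have [N hN] := folner_boundary K fF e0.
exists N; have := size_prodset K (F N); rewrite -(ler_nat R) => /le_trans; apply.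
by rewrite natrD mulrDl mul1r lerD2l; exact: hN.
Qed.

End Real.
End GroupTheory.

(** * Bounded random variables *)

Section BoundedIntegral.
Variables (R : realType) (d : measure_display) (T : measurableType d).
Variable P : probability T R.

Definition bmf (f : T -> R) : Prop :=
  measurable_fun setT f /\ exists M : R, forall x, `|f x| <= M.

Definition expect (f : T -> R) : R := \int[P]_x f x.

Lemma bmf_integrable f : bmf f -> P.-integrable setT (EFin \o f).
Proof.
move=> [mf [M hM]]; apply: measurable_bounded_integrable => //.
  by rewrite ltey_eq fin_num_measure.
exists M; split; first exact: num_real.
by move=> x Mx y _; apply: le_trans (hM y) _; exact: ltW.
Qed.

Lemma bmf_cst c : bmf (fun=> c).
Proof. by split; [exact: measurable_cst | exists `|c|]. Qed.

Lemma bmfD f g : bmf f -> bmf g -> bmf (fun x => f x + g x).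
Proof.
move=> [mf [M hM]] [mg [N hN]]; split; first exact: measurable_funD.
by exists (M + N) => x; apply: le_trans (ler_normD _ _) (lerD _ _).
Qed.

Lemma bmfZ c f : bmf f -> bmf (fun x => c * f x).
Proof.
move=> [mf [M hM]]; split; first by apply: measurable_funM => //; exact: measurable_cst.
by exists (`|c| * M) => x; rewrite normrM ler_wpM2l.
Qed.

Lemma bmfM f g : bmf f -> bmf g -> bmf (fun x => f x * g x).
Proof.
move=> [mf [M hM]] [mg [N hN]]; split; first exact: measurable_funM.
by exists (M * N) => x; rewrite normrM ler_pM.
Qed.

Lemma bmf_norm f : bmf f -> bmf (fun x => `|f x|).
Proof.
move=> [mf [M hM]]; split; last by exists M => x; rewrite normr_id.
by apply: measurableT_comp.
Qed.

Lemma bmfB f g : bmf f -> bmf g -> bmf (fun x => f x - g x).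
Proof.
move=> [mf [M hM]] [mg [N hN]]; split; first exact: measurable_funB.
by exists (M + N) => x; apply: le_trans (ler_normB _ _) (lerD _ _).
Qed.

Lemma bmf_max f g : bmf f -> bmf g -> bmf (fun x => Num.max (f x) (g x)).
Proof.
move=> [mf [M hM]] [mg [N hN]]; split; first exact: measurable_maxr.
exists (Num.max M N) => x; rewrite le_max /Num.max; case: ifP => _.
- by rewrite hN orbT.
- by rewrite hM.
Qed.

Lemma bmf_indic (A : set T) : measurable A -> bmf (\1_A : T -> R).
Proof.
move=> mA; split; first exact: measurable_indic.
by exists 1 => x; rewrite indicE; case: (x \in A); rewrite ?normr1 ?normr0.
Qed.

Lemma bmf_sum (I : Type) (s : seq I) (f : I -> T -> R) :
  (forall i, bmf (f i)) -> bmf (fun x => \sum_(i <- s) f i x).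
Proof.
move=> hf; elim: s => [|i s IH].
  by under eq_fun do rewrite big_nil; exact: bmf_cst.
by under eq_fun do rewrite big_cons; exact: bmfD.
Qed.

Lemma expectD f g : bmf f -> bmf g -> expect (fun x => f x + g x) = expect f + expect g.
Proof. by move=> bf bg; rewrite /expect RintegralD //; exact: bmf_integrable. Qed.

Lemma expectB f g : bmf f -> bmf g -> expect (fun x => f x - g x) = expect f - expect g.
Proof. by move=> bf bg; rewrite /expect RintegralB //; exact: bmf_integrable. Qed.

Lemma expectZ c f : bmf f -> expect (fun x => c * f x) = c * expect f.
Proof. by move=> bf; rewrite /expect RintegralZl //; exact: bmf_integrable. Qed.

Lemma expect_cst c : expect (fun=> c) = c.
Proof.
rewrite /expect Rintegral_cst // -[RHS]mulr1; congr (_ * _).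
exact: (congr1 fine (probability_setT P)).
Qed.

Lemma le_expect f g : bmf f -> bmf g -> (forall x, f x <= g x) -> expect f <= expect g.
Proof. by move=> bf bg h; apply: le_Rintegral => //; exact: bmf_integrable. Qed.

Lemma expect_sum (I : Type) (s : seq I) (f : I -> T -> R) :
  (forall i, bmf (f i)) -> expect (fun x => \sum_(i <- s) f i x) = \sum_(i <- s) expect (f i).
Proof.
move=> hf; elim: s => [|i s IH].
  by rewrite big_nil; under eq_fun do rewrite big_nil; exact: expect_cst.
rewrite big_cons -IH -expectD //; last exact: bmf_sum.
by congr expect; apply: funext => x; rewrite big_cons.
Qed.

Lemma fineP_EFin (A : set T) : measurable A -> P A = (fine (P A))%:E.
Proof. by move=> mA; rewrite fineK // fin_num_measure. Qed.

Lemma expect_indic (A : set T) : measurable A -> expect \1_A = fine (P A).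
Proof. by move=> mA; rewrite /expect /Rintegral integral_indic // setIT. Qed.

Lemma fineP_ge0 (A : set T) : 0 <= fine (P A).
Proof. by rewrite fine_ge0. Qed.

Lemma le_fineP (A B : set T) : measurable A -> measurable B -> A `<=` B ->
  fine (P A) <= fine (P B).
Proof.
move=> mA mB AB; rewrite fine_le ?fin_num_measure //.
by apply: le_measure; rewrite ?inE.
Qed.

Lemma expect_markov f t : bmf f -> (forall x, 0 <= f x) -> 0 < t ->
  fine (P [set x | t <= f x]) <= expect f / t.
Proof.
move=> bf f0 t0; rewrite ler_pdivlMr // mulrC.
have mA : measurable [set x | t <= f x].
  have := bf.1 measurableT `[t, +oo[%classic (measurable_itv _).
  rewrite setTI; congr measurable; apply/seteqP; split => x /=.
    by rewrite in_itv /= andbT.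
  by rewrite in_itv /= andbT.
rewrite -expect_indic // -expectZ; last exact: bmf_indic.
apply: le_expect => //; first by apply: bmfZ; exact: bmf_indic.
move=> x; rewrite indicE; case: (boolP (x \in _)); rewrite ?mulr0 // ?mulr1.
by rewrite inE.
Qed.

Lemma measurable_le_set (f : T -> R) (c : R) : measurable_fun setT f -> measurable [set x | f x <= c].
Proof.
move=> mf; have := mf measurableT `]-oo, c]%classic (measurable_itv _).
by rewrite setTI; congr measurable; apply/seteqP; split => x /=; rewrite in_itv.
Qed.

Lemma measurable_lt_set (f : T -> R) (c : R) : measurable_fun setT f -> measurable [set x | c < f x].
Proof.
move=> mf; rewrite (_ : [set x | c < f x] = ~` [set x | f x <= c]).
  exact/measurableC/measurable_le_set.
by apply/seteqP; split => x /=; rewrite ltNge => /negP.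
Qed.

Lemma measurable_ge_set (f : T -> R) (c : R) : measurable_fun setT f -> measurable [set x | c <= f x].
Proof.
move=> mf; have := mf measurableT `[c, +oo[%classic (measurable_itv _).
by rewrite setTI; congr measurable; apply/seteqP; split => x /=; rewrite in_itv /= andbT.
Qed.

Lemma ae_prob1 (A : set T) : measurable A -> P A = 1%E -> {ae P, forall x, A x}.
Proof.
move=> mA PA; exists (~` A); split=> //; first exact: measurableC.
by rewrite probability_setC // PA subee.
Qed.

Lemma prob0_ae (A : set T) : measurable A -> P A = 0%E -> {ae P, forall x, ~ A x}.
Proof. by move=> mA PA; exists A; split=> // x /= /contrapT. Qed.

Lemma ae_forall_count (G : countType) (Q : G -> T -> Prop) :
  (forall g, {ae P, forall x, Q g x}) -> {ae P, forall x, forall g, Q g x}.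
Proof.
move=> h; have : {ae P, forall x, forall n : nat,
   if unpickle n is Some g then Q g x else True}.
  apply: ae_foralln => n; case: (unpickle n) => [g|]; first exact: h.
  by apply: nearW.
by apply: filterS => x hx g; have := hx (pickle g); rewrite pickleK.
Qed.

Lemma borel_cantelli_geometric (A : nat -> set T) (c q : R) :
  (forall n, measurable (A n)) -> 0 <= c -> 0 <= q < 1 ->
  (forall n, fine (P (A n)) <= c * q ^+ n) ->
  {ae P, forall x, exists N, forall n, (N <= n)%N -> ~ A n x}.
Proof.
move=> mA c0 /andP[q0 q1] hA.
have mL : measurable (lim_sup_set A).
  by apply: bigcap_measurable => // n _; apply: bigcup_measurable.
have : P (lim_sup_set A) = 0%E.
  apply: lim_sup_set_cvg0 => //.
  apply: (@le_lt_trans _ _ (c / (1 - q))%:E); last exact: ltry.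
  apply: lime_le; first by apply: is_cvg_nneseries => n _ _; exact: measure_ge0.
  apply: nearW => n.
  have h m : \sum_(0 <= i < m) (c * q ^+ i) <= c / (1 - q).
    rewrite -mulr_sumr ler_wpM2l //.
    rewrite -[_^-1]mul1r ler_pdivlMr ?subr_gt0 //.
    have -> : (\sum_(0 <= i < m) q ^+ i) * (1 - q) = 1 - q ^+ m.
      elim: m => [|m IH]; first by rewrite big_geq // mul0r expr0 subrr.
      by rewrite big_nat_recr //= mulrDl IH exprS; ring.
    by rewrite gerBl exprn_ge0.
  apply: le_trans (_ : _ <= (\sum_(0 <= i < n) (c * q ^+ i))%:E)%E _; last first.
    by rewrite lee_fin.
  rewrite -sumEFin; apply: lee_sum => i _.
  by have := hA i; rewrite -lee_fin -fineP_EFin //; apply.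
move=> /(prob0_ae mL); apply: filterS => x hx.
apply: contrapT => hN; apply: hx => n _.
apply: contrapT => hn; apply: hN; exists n => m nm Am; apply: hn.
by exists m.
Qed.

Lemma bounded_convergence (f : nat -> T -> R) (M : R) :
  (forall n, measurable_fun setT (f n)) -> (forall n x, 0 <= f n x <= M) ->
  {ae P, forall x, (fun n => f n x) @ \oo --> (0 : R)} ->
  forall e, 0 < e -> exists N, forall n, (N <= n)%N -> expect (f n) <= e.
Proof.
move=> mf bf cf e e0.
have [|||||_ _] := @dominated_convergence _ _ _ P setT measurableT
   (fun n => EFin \o f n) (cst 0%E) (cst M%:E).
- by move=> n; exact/measurable_EFinP.
- exact: measurable_cst.
- by apply: filterS cf => x hx _; apply: cvg_EFin => //; apply: nearW.
- exact: (bmf_integrable (bmf_cst M)).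
- apply: nearW => x n _ /=; rewrite lee_fin.
  by have /andP[f0 fM] := bf n x; rewrite ger0_norm.
rewrite integral0 => /fine_cvgP [_] /cvgrPdist_le /(_ _ e0)[N _ hN].
exists N => n /hN /=; rewrite sub0r normrN => /(le_trans (ler_norm _)).
by [].
Qed.

End BoundedIntegral.

(** * Measure-preserving maps *)

Section Invariance.
Variables (R : realType) (d : measure_display) (T : measurableType d).
Variable P : probability T R.
Variable phi : T -> T.
Hypothesis mphi : measurable_fun setT phi.
Hypothesis Pphi : forall A, measurable A -> P (phi @^-1` A) = P A.

Lemma bmf_comp (f : T -> R) : bmf f -> bmf (f \o phi).
Proof.
move=> [mf [M hM]]; split; first exact: measurableT_comp.
by exists M => x; exact: hM.
Qed.

Lemma expect_comp (f : T -> R) : bmf f -> expect P (f \o phi) = expect P f.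
Proof.
move=> bf; rewrite /expect /Rintegral.
have := @integral_pushforward _ _ _ _ R phi mphi P setT (EFin \o f).
rewrite preimage_setT => h; congr fine.
rewrite -[LHS]h //; first last.
- exact: (bmf_integrable P (bmf_comp bf)).
- by apply/measurable_EFinP; exact: bf.1.
by apply: eq_measure_integral => A mA _; exact: Pphi.
Qed.

Lemma ae_comp (Q : T -> Prop) : {ae P, forall x, Q x} -> {ae P, forall x, Q (phi x)}.
Proof.
move=> [N [mN N0 sN]]; exists (phi @^-1` N); split.
- by rewrite -[X in measurable X]setTI; exact: mphi.
- by rewrite -N0; exact: Pphi.
- by move=> x /= h; exact: sN.
Qed.

End Invariance.

(** * The pointwise ergodic theorem *)

Section Sequences.
Variable R : realType.

Definition tends0 (u : nat -> R) : Prop :=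
  forall e, 0 < e -> exists N, forall n, (N <= n)%N -> `|u n| <= e.

Lemma tends0D u v : tends0 u -> tends0 v -> tends0 (fun n => u n + v n).
Proof.
move=> hu hv e e0.
have [N1 h1] := hu (e / 2) (divr_gt0 e0 (ltr0n _ 2)).
have [N2 h2] := hv (e / 2) (divr_gt0 e0 (ltr0n _ 2)).
exists (maxn N1 N2) => n; rewrite geq_max => /andP[n1 n2].
rewrite [e]splitr; apply: le_trans (ler_normD _ _) (lerD _ _); [exact: h1|exact: h2].
Qed.

Lemma tends0_le u v : (forall n, `|u n| <= `|v n|) -> tends0 v -> tends0 u.
Proof.
move=> h hv e e0; have [N hN] := hv e e0; exists N => n /hN; exact: le_trans.
Qed.

Lemma tends0Z c u : tends0 u -> tends0 (fun n => c * u n).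
Proof.
move=> hu e e0; have [|N hN] := hu (e / (`|c| + 1)).
  by rewrite divr_gt0 // ltr_wpDl.
exists N => n /hN h; rewrite normrM.
have c1 : 0 < `|c| + 1 by rewrite ltr_wpDl.
rewrite ler_pdivlMr // in h.
by have := normr_ge0 c; have := normr_ge0 (u n); nra.
Qed.

Lemma exists_inv_lt (e : R) : 0 < e -> exists j : nat, j.+1%:R^-1 < e.
Proof. by move=> /ltr_add_invr[k]; rewrite add0r; exists k. Qed.

Lemma tends0_inv u : (forall j : nat, exists N, forall n, (N <= n)%N -> `|u n| <= j.+1%:R^-1) ->
  tends0 u.
Proof.
move=> h e /exists_inv_lt[j /ltW je]; have [N hN] := h j.
by exists N => n /hN /le_trans; apply.
Qed.

Lemma tends0_cvg u : tends0 u -> u @ \oo --> (0 : R).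
Proof.
move=> hu; apply/cvgrPdist_le => e e0; have [N hN] := hu e e0.
by exists N => // n /= /hN; rewrite sub0r normrN.
Qed.

Lemma cvg_tends0 u (l : R) : u @ \oo --> l -> tends0 (fun n => u n - l).
Proof.
move=> /cvgrPdist_le hu e e0; have [N _ hN] := hu e e0.
by exists N => n /hN /=; rewrite distrC.
Qed.

Lemma sum_le_subset (I : eqType) (A B : seq I) (f : I -> R) :
  uniq A -> uniq B -> {subset A <= B} -> (forall i, 0 <= f i) ->
  \sum_(i <- A) f i <= \sum_(i <- B) f i.
Proof.
move=> uA uB sAB f0.
rewrite [leRHS](bigID (fun i => i \in A)) /= -[\sum_(i <- B | i \in A) _]big_filter.
rewrite (perm_big [seq i <- B | i \in A]) /=; last first.
  apply: uniq_perm; rewrite ?filter_uniq // => x; rewrite mem_filter.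
  by case: (boolP (x \in A)) => // xA; rewrite (sAB _ xA).
by rewrite lerDl sumr_ge0.
Qed.

End Sequences.

(** Continuity from below reduces events with an unbounded scale to their truncations, where only
    finitely many windows occur and covering arguments apply. *)
Lemma fineP_bigcup (R : realType) d (T : measurableType d) (P : probability T R)
    (B : nat -> set T) (c : R) :
  (forall n, measurable (B n)) -> {homo B : n m / (n <= m)%N >-> n `<=` m} ->
  (forall n, fine (P (B n)) <= c) -> fine (P (\bigcup_n B n)) <= c.
Proof.
move=> mB hB hc.
have mU : measurable (\bigcup_n B n) by exact: bigcup_measurable.
have cv : (P \o B) x @[x --> \oo] --> P (\bigcup_n B n).
  by apply: nondecreasing_cvg_mu => // n m nm; apply/subsetPset; exact: hB.
rewrite -lee_fin -fineP_EFin // -(cvg_lim _ cv) //.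
apply: lime_le; first by apply/cvg_ex; exists (P (\bigcup_n B n)).
by apply: nearW => n /=; rewrite fineP_EFin // lee_fin.
Qed.

(** * Transference and the maximal inequality *)

Section Ergodic.
Variables (R : realType) (G : countType) (Gs : group_str G).
Variables (d : measure_display) (T : measurableType d) (P : probability T R).
Variable act : G -> T -> T.
Hypothesis act1 : forall x, act (gone Gs) x = x.
Hypothesis actM : forall g g' x, act (gmul Gs g g') x = act g (act g' x).
Hypothesis act_meas : forall g, measurable_fun setT (act g).
Hypothesis act_inv : forall g A, measurable A -> P (act g @^-1` A) = P A.
Local Notation "a *g b" := (gmul Gs a b) (at level 40, left associativity).

Lemma act_bmf g (f : T -> R) : bmf f -> bmf (fun x => f (act g x)).
Proof. exact: (bmf_comp (act_meas g)). Qed.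

Lemma act_expect g (f : T -> R) : bmf f -> expect P (fun x => f (act g x)) = expect P f.
Proof. exact: (expect_comp (act_meas g) (@act_inv g)). Qed.

Variable F : nat -> seq G.
Hypothesis Ffol : folner Gs R F.

(** Take [A] to be a Folner set [F n] and integrate the orbit inequality. By invariance the left
    side is [size (F n) * P B] and the right side is [kap * size (K F n) * expect f]; the ratio of
    the two sizes can be brought arbitrarily close to 1. *)
Lemma transference (B : set T) (f : T -> R) (K : seq G) (kap : R) :
  measurable B -> bmf f -> (forall x, 0 <= f x) -> 0 <= kap ->
  (forall A x, uniq A -> \sum_(g <- A) \1_B (act g x) <=
                         kap * \sum_(g <- prodset Gs K A) f (act g x)) ->
  fine (P B) <= kap * expect P f.
Proof.
move=> mB bf f0 k0 h.
have Ef0 : 0 <= expect P f.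
  by rewrite -(expect_cst P 0); apply: (le_expect P (bmf_cst T 0) bf).
apply/ler_addgt0Pr => e e0.
pose c := kap * expect P f.
(* The relative growth [e / (c + 1)] costs at most [e] after multiplication by [c], including when
   [c = 0]. *)
have c1 : 0 < c + 1 by rewrite ltr_wpDl // mulr_ge0.
have [n hn] := folner_growth K Ffol (divr_gt0 e0 c1).
have s0 : 0 < (size (F n))%:R :> R by rewrite ltr0n; have [] := Ffol.1 n.
rewrite -(ler_pM2l s0).
have -> : (size (F n))%:R * fine (P B) =
   expect P (fun x => \sum_(g <- F n) \1_B (act g x)).
  rewrite expect_sum; last by move=> g; apply: act_bmf; exact: bmf_indic.
  rewrite (eq_bigr (fun=> fine (P B))).
    by rewrite big_const_seq count_predT iter_addr_0 mulr_natl.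
  by move=> g _; rewrite (act_expect g (bmf_indic R mB)) expect_indic.
apply: (@le_trans _ _ (expect P (fun x => kap * \sum_(g <- prodset Gs K (F n)) f (act g x)))).
  apply: le_expect.
  - by apply: bmf_sum => g; apply: act_bmf; exact: bmf_indic.
  - by apply: bmfZ; apply: bmf_sum => g; exact: act_bmf.
  - by move=> x; apply: h; have [] := Ffol.1 n.
rewrite expectZ; last by apply: bmf_sum => g; exact: act_bmf.
rewrite expect_sum; last by move=> g; exact: act_bmf.
rewrite (eq_bigr (fun=> expect P f)); last by move=> g _; exact: act_expect.
rewrite big_const_seq count_predT iter_addr_0 -[_ *+ _]mulr_natl mulrCA.
apply: (@le_trans _ _ ((1 + e / (c + 1)) * (size (F n))%:R * c)).
  by rewrite ler_wpM2r // mulr_ge0.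
have hq : e / (c + 1) * c <= e.
  by rewrite mulrAC ler_pdivrMr // ler_wpM2l ?lerDl // ltW.
rewrite -/c (_ : (1 + _) * _ * c = (size (F n))%:R * (c + e / (c + 1) * c)); last by ring.
by rewrite ler_wpM2l ?ler0n // lerD2l.
Qed.

Definition avg (k : nat) (f : T -> R) (x : T) : R :=
  (\sum_(a <- F k) f (act a x)) / (size (F k))%:R.

Let sF0 k : 0 < (size (F k))%:R :> R.
Proof. by rewrite ltr0n; have [] := Ffol.1 k. Qed.

Lemma avgD k f g x : avg k (fun y => f y + g y) x = avg k f x + avg k g x.
Proof. by rewrite /avg big_split mulrDl. Qed.

Lemma avgZ k c f x : avg k (fun y => c * f y) x = c * avg k f x.
Proof. by rewrite /avg -mulr_sumr mulrA. Qed.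

Lemma avg_cst k c x : avg k (fun=> c) x = c.
Proof.
rewrite /avg big_const_seq count_predT iter_addr_0 -[_ *+ _]mulr_natr mulfK //.
exact: lt0r_neq0.
Qed.

Lemma avg_norm k f x : `|avg k f x| <= avg k (fun y => `|f y|) x.
Proof.
rewrite /avg normrM [X in _ * X]ger0_norm ?invr_ge0 //.
by rewrite ler_pM2r ?invr_gt0 //; exact: ler_norm_sum.
Qed.

Lemma avg_bmf k f : bmf f -> bmf (avg k f).
Proof.
move=> bf; rewrite /avg; under eq_fun do rewrite mulrC.
by apply: bmfZ; apply: bmf_sum => a; exact: act_bmf.
Qed.

Hypothesis Ftemp : tempered Gs R F.

(** For scales below [N], apply the covering lemma along each orbit to the function [g |-> f (g x)];
    the set it produces stays inside [K A], where [K] is the union of the first [N] Folner sets, so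
    transference applies. The constant depends only on [lam] and the temperedness constant, so [N]
    can tend to infinity. *)
Lemma maximal_inequality lam : 0 < lam -> exists2 kap, 0 <= kap &
  forall f, bmf f -> (forall x, 0 <= f x <= 1) ->
  fine (P [set x | exists k, lam < avg k f x]) <= kap * expect P f.
Proof.
move=> l0; have [C1 hC1] := Ftemp; pose C := Num.max C1 0.
have C0 : 0 <= C by rewrite le_max lexx orbT.
have hC n : (size (undup [seq a *g b | a <- flatten [seq map (ginv Gs) (F k) | k <- iota 0 n],
                              b <- F n]))%:R <= C * (size (F n))%:R.
  by apply: (le_trans (hC1 n)); rewrite ler_wpM2r // le_max lexx.
have k0 : 0 <= (2 / lam + C) * (2 / lam).
  by rewrite mulr_ge0 ?addr_ge0 // divr_ge0 // ltW.
exists ((2 / lam + C) * (2 / lam)) => // f bf f01.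
have -> : [set x | exists k, lam < avg k f x] =
    \bigcup_N [set x | exists2 k, (k < N)%N & lam < avg k f x].
  apply/seteqP; split => x /=; first by move=> [k hk]; exists k.+1 => //; exists k.
  by move=> [N _ [k _ hk]]; exists k.
apply: fineP_bigcup.
- move=> N; rewrite (_ : [set x | _] = \bigcup_(k in `I_N) [set x | lam < avg k f x]).
    apply: bigcup_measurable => k _; apply: measurable_lt_set.
    by have [] := avg_bmf k bf.
  by apply/seteqP; split=> x /= [k hk hx]; exists k.
- by move=> n m nm x /= [k kn hk]; exists k => //; exact: leq_trans nm.
move=> N; set B := [set x | _].
have mB : measurable B.
  rewrite (_ : B = \bigcup_(k in `I_N) [set x | lam < avg k f x]).
    apply: bigcup_measurable => k _; apply: measurable_lt_set.
    by have [] := avg_bmf k bf.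
  by apply/seteqP; split=> x /= [k hk hx]; exists k.
apply: (@transference B f (flatten [seq F j | j <- iota 0 N])) => //.
  by move=> x; have /andP[] := f01 x.
move=> A x uA.
pose D := [seq g <- A | act g x \in B].
have /choice[k hk] : forall g, exists j, act g x \in B ->
    (j < N)%N /\ lam < avg j f (act g x).
  move=> g; have [|nB] := boolP (act g x \in B); last by exists 0%N.
  by rewrite inE => -[k kN hk]; exists k.
have [|||U [uU sU bU]] := @covering_lemma G Gs R F (fun g => f (act g x)) C lam
     Ffol.1 hC (fun g => f01 (act g x)) l0 C0 N D k.
- by rewrite filter_uniq.
- by move=> b; rewrite mem_filter => /andP[/hk[]].
- move=> b; rewrite mem_filter => /andP[/hk[_]].
  rewrite /avg ltr_pdivlMr // => h _; apply: (le_trans (ltW h)).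
  by rewrite big_map; under [leRHS]eq_bigr do rewrite actM.
have -> : \sum_(g <- A) \1_B (act g x) = (size D)%:R :> R.
  rewrite size_filter -sum1_count natr_sum [RHS]big_mkcond.
  by apply: eq_bigr => g _; rewrite indicE; case: ifP.
apply: (le_trans bU); rewrite ler_wpM2l //.
apply: sum_le_subset => //; first exact: undup_uniq.
  move=> g /sU /flatten_mapP[b]; rewrite mem_filter => /andP[/hk[kN _] bA].
  move=> /mapP[a aF ->]; apply: mem_prodset => //.
  by apply/flatten_mapP; exists (k b) => //; rewrite mem_iota.
by move=> g; have /andP[] := f01 (act g x).
Qed.

(** * Ergodicity and convergence of averages *)

Hypothesis act_erg : forall A, measurable A -> (forall g, act g @^-1` A = A) ->
  P A = 0%E \/ P A = 1%E.

(** Here [S] is invariant only up to null sets, whereas ergodicity is stated for strictly invariant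
    sets. It is applied to the set [A] of points whose whole orbit lies in [S], which agrees with
    [S] almost everywhere. *)
Lemma ergodic_dichotomy (S : set T) : measurable S ->
  (forall g, {ae P, forall x, S x -> S (act g x)}) ->
  {ae P, forall x, S x} \/ {ae P, forall x, ~ S x}.
Proof.
move=> mS hS; pose A := \bigcap_(n : nat) [set x | if unpickle n is Some g then S (act g x) else True].
have mA : measurable A.
  apply: bigcap_measurable => // n _; case: (unpickle n) => [g|].
    by rewrite -[X in measurable X]setTI; exact: act_meas.
  exact: measurableT.
have AP x : A x <-> forall g, S (act g x).
  split=> [Ax g|h n _ /=]; first by have := Ax (pickle g) I; rewrite /= pickleK.
  by case: (unpickle n).
have iA g : act g @^-1` A = A.
  apply/seteqP; split => x /= /AP h; apply/AP => g'.
    by rewrite -[g'](gmulKV Gs g' g) actM.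
  by rewrite -actM.
have [PA0|PA1] := act_erg mA iA; [right|left].
  have : {ae P, forall x, forall g, S x -> S (act g x)} by exact: ae_forall_count.
  apply: filterS2 (prob0_ae mA PA0) => x nA h Sx; apply: nA.
  by apply/AP => g; exact: h.
apply: filterS (ae_prob1 mA PA1) => x /AP h.
by rewrite -[x]act1.
Qed.

(** Markov's inequality for the square at level [4^-n] turns the decay [16^-n] of second moments
    into the summable bound [c * 4^-n], and Borel-Cantelli concludes. *)
Lemma ae_eventually_small (f : nat -> T -> R) (c : R) :
  0 <= c -> (forall n, bmf (f n)) ->
  (forall n, expect P (fun x => f n x * f n x) <= c * (4^-1 * 4^-1) ^+ n) ->
  {ae P, forall x, exists N, forall n, (N <= n)%N -> `|f n x| <= 2^-1 ^+ n}.
Proof.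
move=> c0 bf hf.
have q0 n : 0 < 4^-1 ^+ n :> R by rewrite exprn_gt0.
have : {ae P, forall x, exists N, forall n, (N <= n)%N ->
    ~ [set x | 4^-1 ^+ n <= f n x * f n x] x}.
  apply: (@borel_cantelli_geometric _ _ _ P _ c 4^-1) => //.
  - by move=> n; apply: measurable_ge_set; have [] := bmfM (bf n) (bf n).
  - by rewrite invr_ge0 ler0n /= invf_lt1 ?ltr0n // ltr1n.
  - move=> n; apply: (le_trans (expect_markov P (bmfM (bf n) (bf n)) _ (q0 n))).
      by move=> x; rewrite -expr2 sqr_ge0.
    by rewrite ler_pdivrMr // -mulrA -exprMn; exact: hf.
apply: filterS => x [N hN]; exists N => n /hN /negP; rewrite -ltNge => h.
rewrite -(ler_pXn2r (ltn0Sn 1)) ?nnegrE ?exprn_ge0 ?invr_ge0 //.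
rewrite real_normK ?num_real // expr2 (le_trans (ltW h)) //.
by rewrite expr2 -exprMn -invfM -natrM.
Qed.

Lemma geometric_tail (u : nat -> R) (N : nat) :
  (forall n, (N <= n)%N -> `|u n.+1 - u n| <= 2^-1 ^+ n) ->
  forall m n, (N <= m)%N -> (m <= n)%N -> `|u n - u m| <= 2 * 2^-1 ^+ m.
Proof.
move=> h m n Nm mn.
have q0 k : 0 <= 2^-1 ^+ k :> R by rewrite exprn_ge0 // invr_ge0.
(* The telescoped form of the geometric sum, for which the induction closes. *)
suff : `|u n - u m| <= 2 * (2^-1 ^+ m - 2^-1 ^+ n).
  by move=> /le_trans; apply; rewrite ler_pM2l // gerBl.
rewrite -(subnK mn); elim: (n - m)%N => [|k IH]; first by rewrite add0n !subrr normr0 mulr0.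
rewrite addSn; have := h (k + m)%N (leq_trans Nm (leq_addl _ _)).
have -> : u (k + m).+1 - u m = (u (k + m).+1 - u (k + m)%N) + (u (k + m)%N - u m) by ring.
move=> h1; apply: (le_trans (ler_normD _ _)); apply: (le_trans (lerD h1 IH)).
by rewrite exprS; lra.
Qed.

Lemma tends0_half_power : tends0 (fun n => 2^-1 ^+ n : R).
Proof.
have : (GRing.exp (2^-1 : R)) @ \oo --> (0 : R).
  by apply: cvg_expr; rewrite ger0_norm ?invr_ge0 // invf_lt1 ?ltr1n // ltr0n.
by move=> /cvg_tends0; apply: tends0_le => n; rewrite subr0.
Qed.

(** A substitute for the convex hull of the translates of [phi]. It retains only what the
    minimisation needs: stability under translations and midpoints, a uniform bound, the mean, and
    the asymptotic ergodic averages at every point. *)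
Definition averages (M : R) (phi psi : T -> R) : Prop :=
  [/\ measurable_fun setT psi, forall x, `|psi x| <= M, expect P psi = expect P phi &
      forall x, tends0 (fun k => avg k phi x - avg k psi x)].

Lemma averages_bmf M phi psi : averages M phi psi -> bmf psi.
Proof. by move=> [mp hM _ _]; split=> //; exists M. Qed.

(** Averaging the translate over [F k] means averaging [psi] over [g F k]. The common part cancels,
    leaving at most [M] times the relative size of the symmetric difference. *)
Lemma averages_translate M phi psi g : averages M phi psi ->
  averages M phi (fun x => psi (act g x)).
Proof.
move=> hp; have bp := averages_bmf hp; have [mp hM Ep cp] := hp.
split => //; first by have [] := act_bmf g bp.
  by rewrite act_expect.
move=> x.
suff : tends0 (fun k => avg k psi x - avg k (fun y => psi (act g y)) x).
  move=> h; have := tends0D (cp x) h; apply: tends0_le => n /=.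
  by rewrite addrA subrK.
have h : tends0 (fun k => (symdiff_card (F k) (ltrans Gs g (F k)))%:R /
                  (size (F k))%:R : R).
  have := cvg_tends0 (Ffol.2 g); apply: tends0_le => n; by rewrite subr0.
apply: tends0_le (tends0Z M h) => k /=.
rewrite /avg -mulrBl !normrM mulrA [`|(size (F k))%:R^-1|]ger0_norm ?invr_ge0 //.
rewrite ler_pM2r ?invr_gt0 // [`|M|]ger0_norm //; last first.
  exact: le_trans (normr_ge0 _) (hM x).
rewrite normr_nat.
pose A := F k; pose B := ltrans Gs g A.
have -> : \sum_(a <- F k) psi (act g (act a x)) = \sum_(b <- B) psi (act b x).
  by rewrite big_map; under [in RHS]eq_bigr do rewrite actM.
have -> : \sum_(a <- F k) psi (act a x) - \sum_(b <- B) psi (act b x) =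
   \sum_(a <- [seq a <- A | a \notin B]) psi (act a x)
     - \sum_(b <- [seq b <- B | b \notin A]) psi (act b x).
  rewrite !big_filter.
  rewrite (bigID (fun a => a \in B)) /= [X in _ - X](bigID (fun a => a \in A)) /=.
  have -> : \sum_(a <- F k | a \in B) psi (act a x) = \sum_(b <- B | b \in A) psi (act b x).
    rewrite -big_filter -[RHS]big_filter; apply: perm_big; apply: uniq_perm.
    - by rewrite filter_uniq //; have [] := Ffol.1 k.
    - by rewrite filter_uniq // ltrans_uniq //; have [] := Ffol.1 k.
    - by move=> y; rewrite !mem_filter andbC.
  by ring.
have bd (L : seq G) : `|\sum_(a <- L) psi (act a x)| <= M * (size L)%:R.
  apply: (le_trans (ler_norm_sum _ _ _)); rewrite -sum1_size natr_sum mulr_sumr.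
  by apply: ler_sum => a _; rewrite mulr1.
apply: (le_trans (ler_normB _ _)); apply: (le_trans (lerD (bd _) (bd _))).
by rewrite -mulrDr -natrD.
Qed.

Lemma averages_mid M phi psi1 psi2 : averages M phi psi1 -> averages M phi psi2 ->
  averages M phi (fun x => 2^-1 * (psi1 x + psi2 x)).
Proof.
move=> h1 h2; have b1 := averages_bmf h1; have b2 := averages_bmf h2.
have [m1 M1 E1 c1] := h1; have [m2 M2 E2 c2] := h2; split.
- by have [] := bmfZ 2^-1 (bmfD b1 b2).
- move=> x; rewrite normrM ger0_norm ?invr_ge0 //.
  have := ler_normD (psi1 x) (psi2 x); have := M1 x; have := M2 x; lra.
- by rewrite expectZ ?expectD //; [lra | exact: bmfD].
- move=> x; have := tends0Z 2^-1 (tends0D (c1 x) (c2 x)); apply: tends0_le => k.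
  by rewrite avgZ avgD le_eqVlt; apply/orP; left; apply/eqP; congr `|_|; field.
Qed.

(* A sequence minimising the second moment over the averages of [phi] is fast
   Cauchy by the parallelogram law, and stays so after translation. *)
Lemma minimising_sequence (M : R) (phi : T -> R) : (forall x, `|phi x| <= M) -> measurable_fun setT phi ->
  exists psi : nat -> T -> R, (forall n, averages M phi (psi n)) /\
  {ae P, forall x, (exists N, forall n, (N <= n)%N ->
       `|psi n.+1 x - psi n x| <= 2^-1 ^+ n) /\
     forall g, tends0 (fun n => psi n (act g x) - psi n x)}.
Proof.
move=> hM mphi.
pose S := [set v | exists2 psi, averages M phi psi & v = expect P (fun x => psi x * psi x)].
have S0 : S (expect P (fun x => phi x * phi x)).
  exists phi => //; split=> // x e e0; exists 0%N => n _.
  by rewrite subrr normr0 ltW.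
have lbS : has_lbound S.
  exists 0 => v [psi /averages_bmf bp ->].
  rewrite -(expect_cst P 0); apply: (le_expect P (bmf_cst T 0) (bmfM bp bp)) => x.
  by rewrite -expr2 sqr_ge0.
have hinf : has_inf S by split => //; eexists; exact: S0.
pose m := inf S.
have min psi : averages M phi psi -> m <= expect P (fun x => psi x * psi x).
  by move=> h; apply: ge_inf => //; exists psi.
(* Parallelogram identity; the second moment of the midpoint is at least the infimum [m]. *)
have par psi1 psi2 : averages M phi psi1 -> averages M phi psi2 ->
  expect P (fun x => (psi1 x - psi2 x) * (psi1 x - psi2 x)) <=
  2 * (expect P (fun x => psi1 x * psi1 x) - m) +
  2 * (expect P (fun x => psi2 x * psi2 x) - m).
  move=> h1 h2; have b1 := averages_bmf h1; have b2 := averages_bmf h2.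
  have h3 := averages_mid h1 h2; have b3 := averages_bmf h3.
  have := min _ h3.
  have -> : (fun x => (psi1 x - psi2 x) * (psi1 x - psi2 x)) =
    (fun x => 2 * (psi1 x * psi1 x) + 2 * (psi2 x * psi2 x)
       - 4 * (2^-1 * (psi1 x + psi2 x) * (2^-1 * (psi1 x + psi2 x)))).
    by apply: funext => x; field.
  have s1 := bmfM b1 b1; have s2 := bmfM b2 b2; have s3 := bmfM b3 b3.
  rewrite (expectB P (bmfD (bmfZ 2 s1) (bmfZ 2 s2)) (bmfZ 4 s3)).
  rewrite (expectD P (bmfZ 2 s1) (bmfZ 2 s2)) (expectZ P 2 s1) (expectZ P 2 s2).
  rewrite (expectZ P 4 s3); lra.
(* The rate [16^-n] is the one that yields differences below [2^-n] almost surely. *)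
pose q : R := 4^-1 * 4^-1.
have q0 n : 0 < q ^+ n by rewrite exprn_gt0 // mulr_gt0.
have /choice[psi hpsi] : forall n, exists psi, averages M phi psi /\
    expect P (fun x => psi x * psi x) <= m + q ^+ n.
  move=> n; have [v [psi hp ->] /ltW hv] := inf_adherent (q0 n) hinf.
  by exists psi.
have hp n : averages M phi (psi n) by have [] := hpsi n.
have he n : expect P (fun x => psi n x * psi n x) <= m + q ^+ n by have [] := hpsi n.
exists psi; split => //.
have hq n : q ^+ n.+1 <= q ^+ n.
  rewrite exprS ler_piMl ?ltW // /q -invfM invf_lt1 -?natrM ?ltr1n //.
have A1 : {ae P, forall x, exists N, forall n, (N <= n)%N ->
    `|psi n.+1 x - psi n x| <= 2^-1 ^+ n}.
  apply: (@ae_eventually_small (fun n x => psi n.+1 x - psi n x) 4) => //.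
    by move=> n; apply: bmfB; exact: averages_bmf (hp _).
  move=> n; apply: (le_trans (par _ _ (hp n.+1) (hp n))).
  have := he n; have := he n.+1; have := hq n; rewrite /q; lra.
have A2 g : {ae P, forall x, exists N, forall n, (N <= n)%N ->
    `|psi n (act g x) - psi n x| <= 2^-1 ^+ n}.
  apply: (@ae_eventually_small (fun n x => psi n (act g x) - psi n x) 4) => //.
    move=> n; apply: bmfB; last exact: averages_bmf (hp _).
    exact: act_bmf (averages_bmf (hp n)).
  move=> n; apply: (le_trans (par _ _ (averages_translate g (hp n)) (hp n))).
  have bn := averages_bmf (hp n).
  rewrite (act_expect g (bmfM bn bn)).
  have := he n; rewrite /q; lra.
apply: filterS2 A1 (ae_forall_count A2) => x h1 h2; split => // g e e0.
have [N1 hN1] := h2 g; have [N2 hN2] := tends0_half_power e0.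
exists (maxn N1 N2) => n; rewrite geq_max => /andP[n1 n2].
apply: (le_trans (hN1 n n1)); apply: le_trans (hN2 n n2); exact: ler_norm.
Qed.

(** Almost surely the minimising sequence is Cauchy and asymptotically invariant, so its upper limit
    is governed by the ergodic dichotomy. Only the lower bound by the mean [c] is established
    pointwise; since every [psi n] has mean [c], this already forces convergence in L1. *)
Lemma mean_ergodic (M : R) (phi : T -> R) : (forall x, `|phi x| <= M) ->
  measurable_fun setT phi -> forall e, 0 < e ->
  exists2 psi, averages M phi psi & expect P (fun x => `|psi x - expect P phi|) <= e.
Proof.
move=> hM mphi e e0; pose c := expect P phi.
have [psi [hp hae]] := minimising_sequence hM mphi.
have bp n : bmf (psi n) := averages_bmf (hp n).
have mp n : measurable_fun setT (psi n) by have [] := bp n.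
have pM n x : `|psi n x| <= M by have [] := hp n.
have Ep n : expect P (psi n) = c by have [] := hp n.
have cM : `|c| <= M.
  have bphi : bmf phi by split => //; exists M.
  have hl x : - M <= phi x <= M by rewrite -ler_norml.
  have h1 := le_expect P (bmf_cst T (- M)) bphi (fun x => (andP (hl x)).1).
  have h2 := le_expect P bphi (bmf_cst T M) (fun x => (andP (hl x)).2).
  by rewrite !expect_cst in h1 h2; rewrite ler_norml h1 h2.
(* [S t] is the event limsup psi_n <= t. *)
pose S (t : R) := [set x | forall j : nat, exists N, forall n, (N <= n)%N ->
   psi n x <= t + j.+1%:R^-1].
have mS (t : R) : measurable (S t).
  rewrite (_ : S t = \bigcap_(j : nat) \bigcup_(N : nat) \bigcap_(n : nat)
     [set x | (N <= n)%N -> psi n x <= t + j.+1%:R^-1]).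
    apply: bigcap_measurable => // j _; apply: bigcup_measurable => N _.
    apply: bigcap_measurable => // n _.
    case: (leqP N n) => Nn; last first.
      by rewrite (_ : mkset _ = setT) //; apply/seteqP.
    rewrite (_ : mkset _ = [set x | psi n x <= t + j.+1%:R^-1]).
      exact: measurable_le_set.
    by apply/seteqP; split => x /=; [apply | move=> ?].
  apply/seteqP; split => x /= h.
    by move=> j _; have [N hN] := h j; exists N => // n _; exact: hN.
  by move=> j; have [N _ hN] := h j I; exists N => n; exact: hN.
(* Asymptotic invariance of [psi n] makes [S t] invariant up to a null set. *)
have dS (t : R) : {ae P, forall x, S t x} \/ {ae P, forall x, ~ S t x}.
  apply: ergodic_dichotomy => // g; apply: filterS hae => x [_ /(_ g) hg] Sx j.
  have j0 : 0 < (j.+1%:R^-1 : R) / 2 by rewrite divr_gt0 // invr_gt0.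
  have [i ij] := exists_inv_lt j0.
  have [N1 h1] := Sx i; have [N2 h2] := hg _ j0.
  exists (maxn N1 N2) => n; rewrite geq_max => /andP[/h1 n1 /h2].
  rewrite ler_norml => /andP[_ n2].
  move: n1 n2 ij; move: (i.+1%:R^-1 : R) (j.+1%:R^-1 : R) => vi vj; lra.
(* If the upper limit were at most [t < c] almost surely, the positive parts of [psi n - t'] would
   have means tending to 0, although [psi n - t'] has mean [c - t' > 0]. *)
have S0 (t : R) : t < c -> {ae P, forall x, ~ S t x}.
  move=> tc; have [St|//] := dS t; exfalso.
  pose t' := (t + c) / 2.
  have tt' : t < t' by rewrite /t'; lra.
  have t'c : t' < c by rewrite /t'; lra.
  pose f n x := Num.max (psi n x - t') 0.
  have bf n : bmf (f n) by apply: bmf_max; [apply: bmfB => //; exact: bmf_cst | exact: bmf_cst].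
  have [|||N /(_ N (leqnn N))] := @bounded_convergence _ _ _ P f (M + `|t'|) (fun n => (bf n).1) _ _ ((c - t') / 2).
  - move=> n x; rewrite /f le_max lexx orbT /= ge_max; apply/andP; split.
      apply: le_trans (ler_norm _) (le_trans (ler_normB _ _) _).
      by rewrite lerD2r.
    by rewrite addr_ge0 // (le_trans (normr_ge0 _) cM).
  - apply: filterS St => x Sx; apply: tends0_cvg => a a0.
    have [j jt] : exists j : nat, j.+1%:R^-1 < t' - t.
      by apply: exists_inv_lt; rewrite subr_gt0.
    have [N hN] := Sx j; exists N => n /hN h.
    rewrite /f max_r ?normr0 ?(ltW a0) //.
    by move: h jt; move: (j.+1%:R^-1 : R) => vj; lra.
  - by rewrite divr_gt0 // subr_gt0.
  have : expect P (fun x => psi N x - t') <= expect P (f N).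
    apply: le_expect => //; first by apply: bmfB => //; exact: bmf_cst.
    by move=> x; rewrite /f le_max lexx.
  rewrite expectB ?Ep ?expect_cst //; last exact: bmf_cst.
  by move=> ? ?; lra.
pose f n x := Num.max (c - psi n x) 0.
have bf n : bmf (f n) by apply: bmf_max; [apply: bmfB => //; exact: bmf_cst | exact: bmf_cst].
have f0 n x : 0 <= f n x by rewrite /f le_max lexx orbT.
(* The absolute value is twice the negative part plus the signed value. As [psi n - c] has mean 0,
   only the negative part [f n] matters. *)
have f2 x n : `|psi n x - c| = 2 * f n x + (psi n x - c).
  rewrite /f /Num.max; case: ifPn => h.
    by rewrite ger0_norm ?mulr0 ?add0r //; lra.
  by rewrite ler0_norm; [ring | rewrite -leNgt in h; lra].
have e20 : 0 < e / 2 by rewrite divr_gt0.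
have [||N /(_ N (leqnn N)) hN] := @bounded_convergence _ _ _ P f (`|c| + M) (fun n => (bf n).1) _ _ _ e20.
- move=> n x; rewrite f0 /= /f ge_max; apply/andP; split.
    by apply: le_trans (ler_norm _) (le_trans (ler_normB _ _) _); rewrite lerD2l.
  by rewrite addr_ge0 // (le_trans (normr_ge0 _) cM).
- have hS : {ae P, forall x, forall j : nat, ~ S (c - j.+1%:R^-1) x}.
    by apply: ae_forall_count => j; apply: S0; rewrite ltrBlDr ltrDl invr_gt0.
  apply: filterS2 hae hS => x [[N hN] _] hSx; apply: tends0_cvg => a a0.
  have a40 : 0 < a / 4 by rewrite divr_gt0.
  have [j ja] := exists_inv_lt a40.
  have [N2 hN2] := tends0_half_power a40.
  (* One late index with [psi n x > c - a / 2] suffices: the geometric tail moves later terms by at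
     most another [a / 2]. *)
  have [n0 [n0N hn0]] : exists n, (maxn N N2 <= n)%N /\ c - a / 2 < psi n x.
    apply: contrapT => hno; apply: (hSx j) => i; exists (maxn N N2) => n nN.
    rewrite leNgt; apply/negP => hlt; apply: hno; exists n; split => //.
    have i0 : 0 < (i.+1%:R^-1 : R) by rewrite invr_gt0.
    move: i0 hlt ja; move: (i.+1%:R^-1 : R) (j.+1%:R^-1 : R) => vi vj; lra.
  move: n0N; rewrite geq_max => /andP[n1 n2].
  exists n0 => n n0n.
  have := geometric_tail hN n1 n0n; have := hN2 n0 n2.
  rewrite ger0_norm ?exprn_ge0 ?invr_ge0 // => h1.
  rewrite ler_norml => /andP[h2 _].
  by rewrite ger0_norm // /f ge_max (ltW a0) andbT; lra.
exists (psi N); first exact: hp.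
rewrite -/c.
have -> : (fun x => `|psi N x - c|) = (fun x => 2 * f N x + (psi N x - c)).
  by apply: funext => x; exact: f2.
have bpc : bmf (fun x => psi N x - c) by apply: bmfB => //; exact: bmf_cst.
rewrite (expectD P (bmfZ 2 (bf N)) bpc) (expectZ P 2 (bf N)).
rewrite expectB //; last exact: bmf_cst.
by rewrite Ep expect_cst; lra.
Qed.

(** Replace [phi] by some [psi] with the same asymptotic averages and L1-close to the constant [c].
    The maximal inequality for [|psi - c|] then bounds the probability of a persistent deviation by
    an arbitrarily small number. *)
Theorem pointwise_ergodic (phi : T -> R) : bmf phi ->
  {ae P, forall x, tends0 (fun k => avg k phi x - expect P phi)}.
Proof.
move=> bphi; have [mphi [M0 hM0]] := bphi; pose c := expect P phi.
(* Dividing by [M] brings [|psi - c|] into [0,1], as the maximal inequality requires; the summand 1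
   keeps [M] positive. *)
pose M := M0 + `|c| + 1.
have M00 : 0 <= M0 by apply: le_trans (normr_ge0 _) (hM0 point).
have Mp : 0 < M by rewrite /M; have := normr_ge0 c; lra.
suff h (j : nat) : {ae P, forall x, exists N, forall k, (N <= k)%N ->
    `|avg k phi x - c| <= j.+1%:R^-1}.
  by apply: filterS (ae_foralln h) => x hx; exact: tends0_inv.
(* Half of the deviation is allotted to [avg phi - avg psi], the other half to [avg psi - c]. *)
pose lam : R := j.+1%:R^-1 / 2.
have l0 : 0 < lam by rewrite divr_gt0 // invr_gt0.
have [kap k0 hkap] := maximal_inequality (divr_gt0 l0 Mp).
pose Z := [set x | forall N, exists2 k, (N <= k)%N & j.+1%:R^-1 < `|avg k phi x - c|].
have bk k : bmf (fun x => `|avg k phi x - c|).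
  by apply: bmf_norm; apply: bmfB; [exact: avg_bmf | exact: bmf_cst].
have mZ : measurable Z.
  rewrite (_ : Z = \bigcap_(N : nat) \bigcup_(k in [set k | (N <= k)%N])
      [set x | j.+1%:R^-1 < `|avg k phi x - c|]).
    apply: bigcap_measurable => // N _; apply: bigcup_measurable => k _.
    by apply: measurable_lt_set; have [] := bk k.
  apply/seteqP; split => x /= h.
    by move=> N _; have [k Nk hk] := h N; exists k.
  by move=> N; have [k Nk hk] := h N I; exists k.
suff Z0 : fine (P Z) <= 0.
  have PZ : P Z = 0%E.
    by rewrite fineP_EFin //; congr _%:E; apply/eqP; rewrite eq_le Z0 fineP_ge0.
  apply: filterS (prob0_ae mZ PZ) => x nZ.
  apply: contrapT => hN; apply: nZ => N; apply: contrapT => hk; apply: hN.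
  exists N => k Nk; rewrite leNgt; apply/negP => hlt; apply: hk; by exists k.
apply/ler_addgt0Pr => e e0; rewrite add0r.
have k1 : 0 < kap + 1 by rewrite ltr_wpDl.
have eps0 : 0 < e / (kap + 1) * M by rewrite mulr_gt0 // divr_gt0.
have [psi hpsi Epsi] := mean_ergodic hM0 mphi eps0.
have bpsi := averages_bmf hpsi; have [_ psiM _ cpsi] := hpsi.
pose f x := M^-1 * `|psi x - c|.
have bn : bmf (fun x => `|psi x - c|).
  by apply: bmf_norm; apply: bmfB => //; exact: bmf_cst.
have bf : bmf f by exact: bmfZ.
have f01 x : 0 <= f x <= 1.
  rewrite /f mulr_ge0 ?invr_ge0 ?(ltW Mp) //= mulrC ler_pdivrMr // mul1r.
  have := ler_normB (psi x) c; have := psiM x; rewrite /M; lra.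
have mB : measurable [set x | exists k, lam / M < avg k f x].
  rewrite (_ : [set x | _] = \bigcup_k [set x | lam / M < avg k f x]).
    apply: bigcup_measurable => k _; apply: measurable_lt_set.
    by have [] := avg_bmf k bf.
  by apply/seteqP; split => x /= [k]; [exists k | move=> _ ?; exists k].
apply: (@le_trans _ _ (fine (P [set x | exists k, lam / M < avg k f x]))).
  apply: le_fineP => // x Zx.
  have [N hN] := cpsi x lam l0; have [k Nk hk] := Zx N.
  exists k; rewrite /f avgZ mulrC ltr_pM2l ?invr_gt0 //.
  have := avg_norm k (fun y => psi y - c) x; rewrite avgD avg_cst => h1.
  have h2 := hN k Nk.
  have : `|avg k phi x - c| <= `|avg k phi x - avg k psi x| + `|avg k psi x - c|.
    by rewrite -[X in `|X - c|](subrK (avg k psi x)) -addrA ler_normD.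
  rewrite [j.+1%:R^-1]splitr -/lam in hk.
  clear -hk h1 h2; lra.
apply: (le_trans (hkap f bf f01)).
have hE : expect P f <= e / (kap + 1) by rewrite /f expectZ // mulrC ler_pdivrMr.
apply: (le_trans (ler_wpM2l k0 hE)).
by rewrite mulrA ler_pdivrMr // mulrC ler_wpM2l ?lerDl // ltW.
Qed.

End Ergodic.

(** * Finner's inequality *)

Section RootProducts.
Variable R : realType.

Lemma prod_powR (I : Type) (J : seq I) (r : R) (x : I -> R) : (forall i, 0 <= x i) ->
  \prod_(i <- J) (x i `^ r) = (\prod_(i <- J) x i) `^ r.
Proof.
move=> x0; elim: J => [|i J IH]; first by rewrite !big_nil powR1.
by rewrite !big_cons IH powRM // prodr_ge0.
Qed.

Lemma AGM_powR (I : Type) (J : seq I) (x : I -> R) : (0 < size J)%N -> (forall i, 0 <= x i) ->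
  \prod_(i <- J) (x i `^ (size J)%:R^-1) <= (\sum_(i <- J) x i) / (size J)%:R.
Proof.
move=> J0 x0; rewrite prod_powR //.
have mu0 : 0 <= (\sum_(i <- J) x i) / (size J)%:R by rewrite divr_ge0 // sumr_ge0.
have h : \prod_(i <- J) x i <= ((\sum_(i <- J) x i) / (size J)%:R) ^+ size J.
  have := @leif_AGM R 'I_(size J) predT (fun i => x (tnth (in_tuple J) i)).
  rewrite cardT size_enum_ord => /(_ (fun i _ => x0 _)) [].
  by rewrite -(big_tnth _ _ J predT x) -(big_tnth _ _ J predT x).
apply: (le_trans (ge0_ler_powR _ _ _ h)).
- by rewrite invr_ge0.
- by rewrite nnegrE prodr_ge0.
- by rewrite nnegrE exprn_ge0.
- by rewrite -powR_mulrn // -powRrM divff ?powRr1 // pnatr_eq0 -lt0n.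
Qed.

(** With exactly [m] factors this is Holder's inequality: normalise each [a i] to total mass 1 and
    apply the inequality of arithmetic and geometric means at each [s]. With fewer factors, each
    [a i s] is bounded by its total and the sum over [s] costs [#|S|]. *)
Lemma holder_finType (S : finType) (I : Type) (J : seq I) (m : nat) (a : I -> S -> R) :
  (size J <= m)%N -> (0 < m)%N -> (forall i s, 0 <= a i s) ->
  \sum_s \prod_(i <- J) (a i s `^ m%:R^-1) <=
  (if (size J < m)%N then #|S|%:R else 1) *
    \prod_(i <- J) ((\sum_s a i s) `^ m%:R^-1).
Proof.
move=> Jm m0 a0.
have B0 i : 0 <= \sum_s a i s by exact: sumr_ge0.
have le_aB i s : a i s <= \sum_s a i s.
  by rewrite (bigD1 s) //= lerDl sumr_ge0.
have le_pow i s : 0 <= a i s `^ m%:R^-1 <= (\sum_s a i s) `^ m%:R^-1.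
  by rewrite powR_ge0 ge0_ler_powR ?nnegrE ?invr_ge0.
case: ltnP => [_|mJ].
  apply: (@le_trans _ _ (\sum_(s : S) \prod_(i <- J) ((\sum_s a i s) `^ m%:R^-1))).
    by apply: ler_sum => s _; apply: ler_prod => i _; exact: le_pow.
  by rewrite sumr_const mulr_natl.
have sJ : size J = m by apply/eqP; rewrite eqn_leq Jm mJ.
pose b i s := a i s / \sum_s a i s.
have b0 i s : 0 <= b i s by rewrite divr_ge0.
(* This survives a zero total, because every [a i s] then vanishes. *)
have ab i s : a i s = (\sum_s a i s) * b i s.
  have [B|Bn] := eqVneq (\sum_s a i s) 0.
    by rewrite B mul0r; apply/eqP; rewrite eq_le a0 -{1}B le_aB.
  by rewrite /b mulrC divfK.
have sb i : \sum_s b i s <= 1.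
  rewrite -mulr_suml; have [->|Bn] := eqVneq (\sum_s a i s) 0; first by rewrite mul0r.
  by rewrite divff.
rewrite mul1r.
have -> : \sum_s \prod_(i <- J) (a i s `^ m%:R^-1) =
   \prod_(i <- J) ((\sum_s a i s) `^ m%:R^-1) * \sum_s \prod_(i <- J) (b i s `^ m%:R^-1).
  rewrite mulr_sumr; apply: eq_bigr => s _; rewrite -big_split /=; apply: eq_bigr => i _.
  by rewrite -powRM // -ab.
rewrite ler_piMr ?prodr_ge0 //; first by move=> i _; exact: powR_ge0.
apply: (@le_trans _ _ (\sum_(s : S) (\sum_(i <- J) b i s) / m%:R)).
  by apply: ler_sum => s _; rewrite -sJ; apply: AGM_powR; rewrite ?sJ.
rewrite -mulr_suml exchange_big /= ler_pdivrMr ?ltr0n // mul1r.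
apply: (@le_trans _ _ (\sum_(i <- J) 1)); first exact: ler_sum.
by rewrite big_const_seq count_predT iter_addr_0 sJ.
Qed.

End RootProducts.

(** * Sums over the coordinates of configurations *)

Section CoordinateSums.
Variables (R : realType) (G : eqType) (Sigma : finType).
Implicit Types (y : G -> Sigma) (u : (G -> Sigma) -> R).

Definition upd y (v : G) (s : Sigma) : G -> Sigma := fun g => if g == v then s else y g.

Definition coord_sum (v : G) u : (G -> Sigma) -> R := fun y => \sum_s u (upd y v s).

(** Configurations remain total functions on [G]: summing over the patterns on [V] proceeds one
    coordinate at a time, with the values of [y] elsewhere as parameters. *)
Definition coords_sum (V : seq G) u : (G -> Sigma) -> R := foldl (fun u v => coord_sum v u) u V.

Lemma le_coords_sum V u1 u2 y : (forall y, u1 y <= u2 y) ->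
  coords_sum V u1 y <= coords_sum V u2 y.
Proof.
elim: V u1 u2 => [|v V IH] u1 u2 h /=; first exact: h.
by apply: IH => z; apply: ler_sum => s _; exact: h.
Qed.

Lemma coords_sumZ V c u y : coords_sum V (fun y => c * u y) y = c * coords_sum V u y.
Proof.
elim: V u => [|v V IH] u //=; rewrite -IH; congr coords_sum.
by apply: funext => z; rewrite /coord_sum mulr_sumr.
Qed.

Definition indep u v := forall y s, u (upd y v s) = u y.

Lemma coord_sum_indep u v w : indep u w -> indep (coord_sum v u) w.
Proof.
move=> h y s; apply: eq_bigr => t _; have [->|wv] := eqVneq v w.
  congr u; apply: funext => g; rewrite /upd; by case: eqP.
rewrite -[RHS](h _ s); congr u; apply: funext => g; rewrite /upd.
by case: (eqVneq g v) => [->|//]; rewrite (negbTE wv).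
Qed.

(* Finner's inequality with all exponents equal to [1/m]; a coordinate in fewer
   than [m] of the sets costs a factor [#|Sigma|]. *)
Lemma finner (I : Type) (J : seq I) (dep : I -> G -> bool) (m : nat) (V : seq G)
    (u : I -> (G -> Sigma) -> R) y :
  (0 < m)%N -> (forall i y, 0 <= u i y) ->
  (forall i v, ~~ dep i v -> indep (u i) v) ->
  (forall v, (count (fun i => dep i v) J <= m)%N) ->
  coords_sum V (fun y => \prod_(i <- J) (u i y `^ m%:R^-1)) y <=
  #|Sigma|%:R ^+ count (fun v => (count (fun i => dep i v) J < m)%N) V *
  \prod_(i <- J) (coords_sum [seq v <- V | dep i v] (u i) y `^ m%:R^-1).
Proof.
move=> m0; elim: V u => [|v V IH] u u0 ui hJ /=; first by rewrite expr0 mul1r.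
(* Summing out [v] replaces each factor that depends on [v] by its sum over that coordinate; the
   other factors leave the sum unchanged, and Holder handles the rest. *)
pose u' i := if dep i v then coord_sum v (u i) else u i.
have u'0 i z : 0 <= u' i z.
  by rewrite /u'; case: ifP => _ //; exact: sumr_ge0.
have u'i i w : ~~ dep i w -> indep (u' i) w.
  by move=> /ui h; rewrite /u'; case: ifP => _ //; exact: coord_sum_indep.
pose c : R := if (count (fun i => dep i v) J < m)%N then #|Sigma|%:R else 1.
have c0 : 0 <= c by rewrite /c; case: ifP.
have step z : coord_sum v (fun y => \prod_(i <- J) (u i y `^ m%:R^-1)) z <=
   c * \prod_(i <- J) (u' i z `^ m%:R^-1).
  have split1 s : \prod_(i <- J) (u i (upd z v s) `^ m%:R^-1) =
      \prod_(i <- [seq i <- J | ~~ dep i v]) (u' i z `^ m%:R^-1) *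
      \prod_(i <- [seq i <- J | dep i v]) (u i (upd z v s) `^ m%:R^-1).
    rewrite (bigID (fun i => dep i v)) /= mulrC !big_filter; congr (_ * _).
    by apply: eq_bigr => i ni; rewrite /u' (negbTE ni) ui.
  have hold := @holder_finType R Sigma I [seq i <- J | dep i v] m
    (fun i s => u i (upd z v s)).
  rewrite size_filter -/c in hold.
  have {}hold := hold (hJ v) m0 (fun i s => u0 i (upd z v s)).
  rewrite /coord_sum (eq_bigr _ (fun s _ => split1 s)) -mulr_sumr.
  have -> : \prod_(i <- J) (u' i z `^ m%:R^-1) =
      \prod_(i <- [seq i <- J | ~~ dep i v]) (u' i z `^ m%:R^-1) *
      \prod_(i <- [seq i <- J | dep i v]) ((\sum_s u i (upd z v s)) `^ m%:R^-1).
    rewrite (bigID (fun i => dep i v)) /= mulrC !big_filter; congr (_ * _).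
    by apply: eq_bigr => i di; rewrite /u' di.
  rewrite mulrCA ler_wpM2l // prodr_ge0 // => i _; exact: powR_ge0.
apply: (le_trans (le_coords_sum V y step)); rewrite coords_sumZ.
apply: (le_trans (ler_wpM2l c0 (IH u' u'0 u'i hJ))).
rewrite mulrA exprD le_eqVlt; apply/orP; left; apply/eqP; congr (_ * _).
  by rewrite /c; case: ifP => _; rewrite ?expr1 ?expr0.
by apply: eq_bigr => i _; rewrite /u'; case: ifP.
Qed.

End CoordinateSums.

(** * Finite-valued random variables and cylinder sets *)

Section FiniteValued.
Variables (R : realType) (d : measure_display) (T : measurableType d) (P : probability T R).
Variables (S : finType) (Z : T -> S).
Hypothesis mZ : forall s, measurable (Z @^-1` [set s]).

Lemma fineP_partition (B : set T) : measurable B ->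
  \sum_s fine (P (B `&` Z @^-1` [set s])) = fine (P B).
Proof.
move=> mB; have mBs s : measurable (B `&` Z @^-1` [set s]) by exact: measurableI.
rewrite -expect_indic // (_ : \1_B = fun x => \sum_s \1_(B `&` Z @^-1` [set s]) x).
  rewrite expect_sum; last by move=> s; exact: bmf_indic.
  by apply: eq_bigr => s _; rewrite expect_indic.
apply: funext => x; rewrite (bigD1 (Z x)) //= big1 ?addr0.
  by rewrite !indicE in_setI [x \in _ @^-1` _]mem_set // andbT.
move=> s sx; rewrite indicE in_setI [x \in _ @^-1` _]memNset ?andbF //=.
by move=> h; rewrite h eqxx in sx.
Qed.

Lemma finite_valued_sum (q : S -> R) :
  (fun x => q (Z x)) = (fun x => \sum_s q s * \1_(Z @^-1` [set s]) x).
Proof.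
apply: funext => x; rewrite (bigD1 (Z x)) //= big1 ?addr0.
  by rewrite indicE mem_set ?mulr1.
move=> s sx; rewrite indicE memNset ?mulr0 //=.
by move=> h; rewrite h eqxx in sx.
Qed.

Lemma finite_valued_bmf (q : S -> R) : bmf (fun x => q (Z x)).
Proof. by rewrite finite_valued_sum; apply: bmf_sum => s; apply: bmfZ; exact: bmf_indic. Qed.

Lemma finite_valued_expect (q : S -> R) :
  expect P (fun x => q (Z x)) = \sum_s q s * fine (P (Z @^-1` [set s])).
Proof.
rewrite finite_valued_sum expect_sum; last by move=> s; apply: bmfZ; exact: bmf_indic.
apply: eq_bigr => s _; rewrite expectZ ?expect_indic //; exact: bmf_indic.
Qed.

End FiniteValued.

Section Cylinders.
Variables (R : realType) (G : eqType) (Sigma : finType).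
Variables (d : measure_display) (T : measurableType d) (P : probability T R).
Variable Y : G -> T -> Sigma.
Hypothesis mY : forall v s, measurable (Y v @^-1` [set s]).

Definition cylinder (V : seq G) (y : G -> Sigma) : set T :=
  [set x | all (fun v => Y v x == y v) V].

Lemma cylinder_cons v V y : cylinder (v :: V) y = cylinder V y `&` Y v @^-1` [set y v].
Proof.
apply/seteqP; split => x; rewrite /cylinder /=; first by move=> /andP[/eqP].
by move=> [-> ->]; rewrite eqxx.
Qed.

Lemma cylinder_upd V v s y : v \notin V -> cylinder V (upd y v s) = cylinder V y.
Proof.
move=> vV; apply: funext => x; rewrite /cylinder /mkset; congr is_true.
apply: eq_in_all => w wV; rewrite /upd.
have wv : w != v by apply: contraNneq vV => <-.
by rewrite (negbTE wv).
Qed.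

Lemma measurable_cylinder V y : measurable (cylinder V y).
Proof.
elim: V => [|v V IH]; first by rewrite (_ : cylinder _ _ = setT) //; exact/seteqP.
by rewrite cylinder_cons; exact: measurableI.
Qed.

Lemma cylinder_decomposition (B : set T) (V : seq G) (y : G -> Sigma) : measurable B ->
  uniq V -> coords_sum V (fun y => fine (P (B `&` cylinder V y))) y = fine (P B).
Proof.
move=> mB; elim: V y => [|v V IH] y /=.
  by move=> _; rewrite (_ : B `&` _ = B) //; apply/seteqP; split => x // [].
move=> /andP[vV uV]; rewrite -[RHS](IH y uV); congr coords_sum; apply: funext => z.
rewrite /coord_sum -(fineP_partition P (mY v)); last first.
  by apply: measurableI => //; exact: measurable_cylinder.
apply: eq_bigr => s _; congr (fine (P _)).
by rewrite cylinder_cons cylinder_upd // setIA /upd eqxx.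
Qed.

Lemma cylinder_total (V : seq G) (y : G -> Sigma) : uniq V ->
  coords_sum V (fun y => fine (P (cylinder V y))) y = 1.
Proof.
move=> uV; have := @cylinder_decomposition setT V y measurableT uV.
rewrite probability_setT => /= <-; congr (coords_sum _ _ _).
by apply: funext => z; rewrite setTI.
Qed.

Lemma cylinder_indep (V : seq G) v : v \notin V ->
  indep (fun y => fine (P (cylinder V y))) v.
Proof.
by move=> vV y s; rewrite cylinder_upd.
Qed.

End Cylinders.

(** * Recurrence and the filling property *)

Section Recurrence.
Variables (R : realType) (G : countType) (Gs : group_str G).
Variables (d : measure_display) (T : measurableType d) (P : probability T R).
Variables (Sigma : finType) (act : G -> T -> T) (X : T -> Sigma).
Hypothesis actM : forall g g' x, act (gmul Gs g g') x = act g (act g' x).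
Hypothesis act_meas : forall g, measurable_fun setT (act g).
Hypothesis act_inv : forall g A, measurable A -> P (act g @^-1` A) = P A.
Hypothesis X_meas : forall s, measurable (X @^-1` [set s]).
Local Notation "a *g b" := (gmul Gs a b) (at level 40, left associativity).
Local Notation inv := (ginv Gs).

Lemma measurable_act_preimage g (A : set T) : measurable A -> measurable (act g @^-1` A).
Proof. by move=> mA; rewrite -[X in measurable X]setTI; exact: act_meas. Qed.

Lemma measurable_symbol g s : measurable ((fun x => X (act g x)) @^-1` [set s]).
Proof. exact: (measurable_act_preimage g (X_meas s)). Qed.

Definition pattern_tuple (A : seq G) (x : T) : (size A).-tuple Sigma :=
  map_tuple (fun a => X (act a x)) (in_tuple A).

Lemma pattern_tupleE A x : val (pattern_tuple A x) = pattern act X A x.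
Proof. by []. Qed.

Lemma measurable_pattern A w : measurable [set x | pattern act X A x = w].
Proof.
elim: A w => [|a A IH] [|s w].
- by rewrite (_ : mkset _ = setT) //; apply/seteqP; split.
- by rewrite (_ : mkset _ = set0) //; apply/seteqP; split.
- by rewrite (_ : mkset _ = set0) //; apply/seteqP; split.
rewrite (_ : mkset _ = (fun x => X (act a x)) @^-1` [set s] `&` [set x | pattern act X A x = w]).
  by apply: measurableI => //; exact: measurable_symbol.
by apply/seteqP; split => x /=; [move=> [-> ->] | move=> [-> ->]].
Qed.

Lemma measurable_pattern_tuple A w : measurable (pattern_tuple A @^-1` [set w]).
Proof.
rewrite (_ : _ @^-1` _ = [set x | pattern act X A x = val w]).
  exact: measurable_pattern.
apply/seteqP; split => x /=; first by move=> <-.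
by move=> h; apply: val_inj.
Qed.

Lemma measurable_repeats A f : measurable [set x | repeats_at act X A x f].
Proof.
rewrite (_ : mkset _ = \bigcup_(w in [set: (size A).-tuple Sigma])
   (pattern_tuple A @^-1` [set w] `&` act f @^-1` (pattern_tuple A @^-1` [set w]))).
  apply: fin_bigcup_measurable => // w _; apply: measurableI.
    exact: measurable_pattern_tuple.
  exact: measurable_act_preimage (measurable_pattern_tuple _).
apply/seteqP; split => x; rewrite /repeats_at /=.
  move=> /eqP h; exists (pattern_tuple A x) => //; split => //=.
  by apply: val_inj; rewrite !pattern_tupleE.
by move=> [w _ /= [<-]] /(congr1 val); rewrite !pattern_tupleE => ->.
Qed.

Lemma measurable_valid A W E : measurable [set x | valid_E Gs act X A W x E].
Proof.
have mall : measurable [set x | all (repeats_at act X A x) E].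
  elim: E => [|e E IH]; first by rewrite (_ : mkset _ = setT) //; apply/seteqP; split.
  rewrite (_ : mkset _ = [set x | repeats_at act X A x e] `&`
     [set x | all (repeats_at act X A x) E]).
    by apply: measurableI => //; exact: measurable_repeats.
  by apply/seteqP; split => x /=; [move=> /andP[] | move=> [-> ->]].
rewrite /valid_E; case: (_ \in E) => /=; last first.
  by rewrite (_ : mkset _ = set0) //; apply/seteqP; split.
case: (all _ E) => /=; last first.
  by rewrite (_ : mkset _ = set0) //; apply/seteqP; split.
case: (all _ E) => //=.
by rewrite (_ : mkset _ = set0) //; apply/seteqP; split.
Qed.

(** For windows containing the identity this is the event [U_kn < delta], with the maximum unfolded
    into a condition on every admissible set. *)
Definition sparse (A W : seq G) (delta : R) : set T :=
  [set x | forall m : (size W).-tuple bool, valid_E Gs act X A W x (mask m W) ->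
     (size (mask m W))%:R < delta * (size W)%:R].

Lemma measurable_sparse A W delta : measurable (sparse A W delta).
Proof.
rewrite (_ : sparse A W delta = \bigcap_(m in [set: (size W).-tuple bool])
   [set x | valid_E Gs act X A W x (mask m W) -> (size (mask m W))%:R < delta * (size W)%:R]).
  apply: fin_bigcap_measurable => // m _.
  case: (_ < _).
    by rewrite (_ : mkset _ = setT) //; apply/seteqP; split.
  rewrite (_ : mkset _ = ~` [set x | valid_E Gs act X A W x (mask m W)]).
    exact/measurableC/measurable_valid.
  by apply/seteqP; split => x /= h; [move=> /h | move=> /h].
by apply/seteqP; split => x /= h; [move=> m _; exact: h | move=> m; exact: h].
Qed.

Lemma cylinder_pattern A y x x' :
  cylinder (fun v x => X (act v x)) A y x -> cylinder (fun v x => X (act v x)) A y x' ->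
  pattern act X A x = pattern act X A x'.
Proof.
move=> /allP h /allP h'; apply/eq_in_map => a aA.
by rewrite (eqP (h a aA)) (eqP (h' a aA)).
Qed.

Variable F : nat -> seq G.
Hypothesis Ffol : folner Gs R F.

(** All points of the event share the pattern [y] on [A], so from one visit of an orbit to the event
    every other visit is a repetition. Thinning the visits inside a window to disjoint translates of
    [A] gives an admissible set, so visits have density at most [size A ^ 2 * delta] there. The
    filling property and transference turn this into a bound on the probability. *)
Lemma sparse_cylinder (W : nat -> seq G) (C delta : R) (A : seq G) y N :
  filling_with Gs W C -> (0 < size A)%N -> 0 <= delta ->
  fine (P ([set x | exists2 n, (n < N)%N & sparse A (W n) delta x] `&`
           cylinder (fun v x => X (act v x)) A y))
    <= (size A ^ 2)%:R * delta / C.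
Proof.
move=> fW A0 d0; have [C0 [uW _]] := fW.
set B := _ `&` _.
have mB : measurable B.
  apply: measurableI; last by apply: measurable_cylinder => v s; exact: measurable_symbol.
  rewrite (_ : mkset _ = \bigcup_(n in `I_N) sparse A (W n) delta).
    by apply: bigcup_measurable => n _; exact: measurable_sparse.
  by apply/seteqP; split => x /= [n nN hn]; exists n.
have kap0 : 0 <= (size A ^ 2)%:R * delta / C.
  by rewrite divr_ge0 ?mulr_ge0 // ltW.
have := @transference R G Gs d T P act act_meas act_inv F Ffol B (fun=> 1)
   (flatten [seq W n | n <- iota 0 N]) ((size A ^ 2)%:R * delta / C) mB (bmf_cst T 1).
rewrite expect_cst mulr1; apply => //.
move=> D x uD.
rewrite big_const_seq count_predT iter_addr_0.
pose D' := [seq g <- D | act g x \in B].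
have -> : \sum_(g <- D) \1_B (act g x) = (size D')%:R :> R.
  rewrite size_filter -sum1_count natr_sum [RHS]big_mkcond.
  by apply: eq_bigr => g _; rewrite indicE; case: ifP.
have D'B g : g \in D' -> B (act g x) by rewrite mem_filter => /andP[/set_mem].
have /choice[n hn] : forall g, exists n, g \in D' ->
    (n < N)%N /\ sparse A (W n) delta (act g x).
  move=> g; have [/D'B[[n nN hn] _]|_] := boolP (g \in D'); last by exists 0%N.
  by exists n.
have uD' : uniq D' by rewrite filter_uniq.
have := @filling_count G Gs R W C ((size A ^ 2)%:R * delta) D' n fW.
rewrite mulr_ge0 // => /(_ isT uD') => hfc.
rewrite -(ler_pM2l C0) mulrA [C * (_ / C)]mulrC divfK ?lt0r_neq0 //.
apply: (le_trans (hfc _)); last first.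
  rewrite ler_wpM2l ?mulr_ge0 // ler_nat; apply: uniq_leq_size; first exact: undup_uniq.
  move=> g; rewrite mem_undup => /flatten_mapP[b bD' /mapP[a aW ->]].
  apply: mem_prodset; last by move: bD'; rewrite mem_filter => /andP[].
  apply/flatten_mapP; exists (n b) => //.
  by rewrite mem_iota /=; have [] := hn b bD'.
move=> g gD'; have [_ sp] := hn g gD'.
pose V := W (n g).
(* The visits in the window around [g], recentred at [g]; the identity is among them. *)
pose D2 := [seq f <- V | f *g g \in D'].
have [u1 o1] := uW (n g).
have oD2 : gone Gs \in D2 by rewrite mem_filter gmul1 gD' o1.
have [E [uE oE sE pE bE]] := disjoint_translates Gs A0 oD2 (filter_uniq _ u1).
have leE : (size E)%:R < delta * (size V)%:R.
  (* [sparse] quantifies over masks, so [E] is rewritten as the submask of [V] with the same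
     elements. *)
  pose m : (size V).-tuple bool := map_tuple (fun v => v \in E) (in_tuple V).
  have Em : mask m V = [seq v <- V | v \in E] by rewrite filter_mask.
  have peE : perm_eq E (mask m V).
    apply: uniq_perm => //; first by rewrite Em filter_uniq.
    move=> v; rewrite Em mem_filter; case: (boolP (v \in E)) => // /sE.
    by rewrite mem_filter => /andP[_ ->].
  rewrite (perm_size peE); apply: sp; rewrite /valid_E.
  have memE v : v \in mask m V -> v \in E by rewrite (perm_mem peE).
  apply/and4P; split.
  - by rewrite -(perm_mem peE).
  - by apply/allP => v /memE /sE; rewrite mem_filter => /andP[].
  - apply/allP => e1 /memE h1; apply/allP => e2 /memE h2.
    by have [//|ne] := eqVneq e1 e2; exact: pE.
  - apply/allP => v /memE /sE; rewrite mem_filter => /andP[vg vV].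
    rewrite /repeats_at -actM; apply/eqP; apply: (@cylinder_pattern A y).
      by have [] := D'B _ vg.
    by have [] := D'B _ gD'.
apply: (@le_trans _ _ ((size D2)%:R)).
  rewrite ler_nat -size_filter.
  rewrite -(size_map (fun f => f *g g) D2); apply: uniq_leq_size; first exact: filter_uniq.
  move=> z; rewrite mem_filter mem_rtrans => /andP[zV zD].
  by apply/mapP; exists (z *g inv g); rewrite ?gmulKV // mem_filter gmulKV zD zV.
apply: (@le_trans _ _ ((size E * size A ^ 2)%:R)); first by rewrite ler_nat.
by rewrite natrM mulrC -mulrA ler_wpM2l // ltW.
Qed.

End Recurrence.

(** * Coding by local pattern probabilities *)

Section Coding.
Variables (R : realType) (G : countType) (Gs : group_str G).
Variables (d : measure_display) (T : measurableType d) (P : probability T R).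
Variables (Sigma : finType) (act : G -> T -> T) (X : T -> Sigma).
Hypothesis actM : forall g g' x, act (gmul Gs g g') x = act g (act g' x).
Hypothesis act_meas : forall g, measurable_fun setT (act g).
Hypothesis act_inv : forall g A, measurable A -> P (act g @^-1` A) = P A.
Hypothesis X_meas : forall s, measurable (X @^-1` [set s]).
Local Notation "a *g b" := (gmul Gs a b) (at level 40, left associativity).
Local Notation inv := (ginv Gs).
Local Notation symbol := (fun v x => X (act v x)).

Variable M : seq G.

Definition pattern_weight (w : (size M).-tuple Sigma) : R :=
  fine (P [set x | pattern act X M x = val w]).

Definition pattern_prob (x : T) : R := pattern_weight (pattern_tuple act X M x).

Let shifted f v x := X (act (v *g inv f) x).

(** By invariance this is the probability of the pattern of [y] on the part of [M f] inside [A].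
    Moving the window back to [M] makes the comparison with [pattern_prob] a plain inclusion of
    events. *)
Definition local_prob (A : seq G) (f : G) (y : G -> Sigma) : R :=
  fine (P (cylinder (shifted f) [seq v <- A | v \in rtrans Gs M f] y)).

Definition coding_weight (A : seq G) (y : G -> Sigma) : R :=
  \prod_(f <- A) (local_prob A f y `^ (size M)%:R^-1).

Definition deficient (A : seq G) : nat :=
  count (fun v => (count (fun f => v \in rtrans Gs M f) A < size M)%N) A.

Let m_shifted f v s : measurable (shifted f v @^-1` [set s]).
Proof. exact: (measurable_symbol act_meas X_meas). Qed.

(** Finner's inequality for the windows [M f]: a site [v] lies in at most [size M] of them, since
    [f |-> v f^-1] is injective into [M], and the local probabilities of each window sum to 1. Only
    deficient sites cost a factor [#|Sigma|]. *)
Lemma coding_weight_sum A y : uniq A -> uniq M -> (0 < size M)%N ->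
  coords_sum A (coding_weight A) y <= #|Sigma|%:R ^+ deficient A.
Proof.
move=> uA uM M0.
have := @finner R G Sigma G A (fun f v => v \in rtrans Gs M f) (size M) A
  (fun f z => local_prob A f z) y M0.
move=> h; apply: (le_trans (h _ _ _)).
- by move=> f z; exact: fineP_ge0.
- move=> f v nv; apply: cylinder_indep.
  by rewrite mem_filter (negbTE nv).
- move=> v; rewrite -size_filter -(size_map (fun f => v *g inv f)).
  apply: uniq_leq_size.
    rewrite map_inj_uniq ?filter_uniq // => f f' /gmulIl; exact: ginv_inj.
  by move=> z /mapP[f]; rewrite mem_filter mem_rtrans => /andP[h' _] ->.
- rewrite big1 ?mulr1 // => f _.
  by rewrite (cylinder_total P (m_shifted f)) ?powR1 // filter_uniq.
Qed.

(** If [v] lies in [a A] for all [a] in [M], the sites [a^-1 v] are [size M] distinct elements of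
    [A] whose windows contain [v]. A deficient site thus lies in [A] minus [a A] for some [a]. *)
Lemma deficient_le A : uniq M -> (deficient A <= \sum_(a <- M) symdiff_card A (ltrans Gs a A))%N.
Proof.
move=> uM; have -> : deficient A = (\sum_(v <- A)
    (count (fun f => v \in rtrans Gs M f) A < size M))%N.
  by rewrite /deficient -sum1_count big_mkcond; apply: eq_bigr => v _; case: ifP.
apply: (@leq_trans (\sum_(a <- M) \sum_(v <- A) (v \notin ltrans Gs a A))%N); last first.
  apply: leq_sum => a _; rewrite /symdiff_card size_filter -sum1_count.
  apply: leq_trans (leq_addr _ _); rewrite [leqRHS]big_mkcond.
  by apply: leq_sum => v _; case: ifP.
rewrite exchange_big /=; apply: leq_sum => v _.
have [all_in|] := boolP (all (fun a => v \in ltrans Gs a A) M); last first.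
  move=> /allPn[a aM nv]; rewrite (big_rem a) //= nv.
  by apply: leq_trans (leq_addr _ _); case: (_ < _)%N.
suff h : (size M <= count (fun f => v \in rtrans Gs M f) A)%N by rewrite ltnNge h.
rewrite -size_filter -(size_map (fun a => inv a *g v) M); apply: uniq_leq_size.
  by rewrite map_inj_uniq // => a b /gmulIr; exact: ginv_inj.
move=> z /mapP[a aM ->]; rewrite mem_filter.
have := allP all_in a aM; rewrite mem_ltrans => ->; rewrite andbT.
by apply/mapP; exists a; rewrite ?gmulVKV.
Qed.

(** Truncating the window to [A] drops constraints and so enlarges the event. *)
Lemma pattern_prob_le_local A y f x : x \in cylinder symbol A y ->
  pattern_prob (act f x) <= local_prob A f y.
Proof.
move=> /set_mem /allP xy; apply: le_fineP; first exact: measurable_pattern.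
  exact: measurable_cylinder.
move=> x' /= px; apply/allP => v; rewrite mem_filter => /andP[vf vA].
have /eqP <- := xy v vA.
have /mapP[a aM ->] := vf.
by move/eq_in_map: px => /(_ a aM) E; rewrite /shifted gmulK actM E.
Qed.

Definition good (A : seq G) (t : R) : set T :=
  [set x | t <= \prod_(f <- A) (pattern_prob (act f x) `^ (size M)%:R^-1)].

Lemma pattern_prob_bmf : bmf pattern_prob.
Proof.
exact: (finite_valued_bmf (measurable_pattern_tuple act_meas X_meas (A := M)) pattern_weight).
Qed.

Lemma measurable_good A t : measurable (good A t).
Proof.
apply: measurable_ge_set.
elim: A => [|a A IH]; first by under eq_fun do rewrite big_nil; exact: measurable_cst.
under eq_fun do rewrite big_cons; apply: measurable_funM => //.
pose q w := pattern_weight w `^ (size M)%:R^-1.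
have := finite_valued_bmf (measurable_pattern_tuple act_meas X_meas (A := M)) q.
by move=> /(act_bmf act_meas a) [].
Qed.

(** This replaces counting typical patterns. A pattern [y] met by a good point has [coding_weight]
    at least [t], so its share [kap] is at most [kap / t] times that weight, and the weights have a
    controlled sum. *)
Lemma good_bound (B : set T) (A : seq G) (t kap : R) (y0 : G -> Sigma) :
  measurable B -> uniq A -> uniq M -> (0 < size M)%N -> 0 < t -> 0 <= kap ->
  (forall y, fine (P (B `&` cylinder symbol A y)) <= kap) ->
  fine (P (B `&` good A t)) <= kap / t * #|Sigma|%:R ^+ deficient A.
Proof.
move=> mB uA uM M0 t0 k0 hB.
have mS v s : measurable (symbol v @^-1` [set s]) by exact: (measurable_symbol act_meas X_meas v s).
have mBg : measurable (B `&` good A t) by apply: measurableI => //; exact: measurable_good.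
rewrite -(@cylinder_decomposition R G Sigma d T P symbol mS _ A y0 mBg uA).
have kt0 : 0 <= kap / t by rewrite divr_ge0 // ltW.
apply: (@le_trans _ _ (coords_sum A (fun y => kap / t * coding_weight A y) y0)); last first.
  by rewrite coords_sumZ ler_wpM2l //; exact: coding_weight_sum.
apply: le_coords_sum => y.
have w0 : 0 <= coding_weight A y.
  by rewrite /coding_weight prodr_ge0 // => f _; exact: powR_ge0.
have mC : measurable (cylinder symbol A y) by exact: measurable_cylinder.
have [[x [[Bx gx] cx]]|none] := pselect (exists x, (B `&` good A t `&` cylinder symbol A y) x); last first.
  have e0 : B `&` good A t `&` cylinder symbol A y = set0.
    by apply/seteqP; split => // x hx; apply: none; exists x.
  by rewrite e0 measure0 mulr_ge0.
have tw : t <= coding_weight A y.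
  apply: (le_trans gx); apply: ler_prod => f _; rewrite powR_ge0 /=.
  apply: ge0_ler_powR; rewrite ?invr_ge0 ?nnegrE ?fineP_ge0 //.
  by apply: pattern_prob_le_local; rewrite inE.
apply: (@le_trans _ _ kap).
  apply: le_trans (hB y); apply: le_fineP; first exact: measurableI.
    exact: measurableI.
  by move=> x' [[]].
by rewrite mulrAC ler_pdivlMr // ler_wpM2l.
Qed.

Lemma expect_pattern_information :
  expect P (fun x => - ln (pattern_prob x)) = ln 2 * joint_entropy P act X M.
Proof.
have := finite_valued_expect P (measurable_pattern_tuple act_meas X_meas (A := M))
  (fun w => - ln (pattern_weight w)).
rewrite -[X in expect P X]/(fun x => - ln (pattern_prob x)) => ->.
rewrite /joint_entropy mulr_sumr; apply: eq_bigr => w _.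
rewrite (_ : _ @^-1` _ = [set x | pattern act X M x = val w]); last first.
  apply/seteqP; split => x /=; first by move=> <-.
  by move=> h; apply: val_inj.
rewrite /= -/(pattern_weight w); case: eqVneq => [->|p0]; first by rewrite !mulr0.
have l2 : ln 2 != 0 :> R by rewrite gt_eqF // ln_gt0 // ltr1n.
by rewrite /log2; field.
Qed.

(** Finitely many patterns have probability zero, and each is seen on a null set. Positivity is what
    allows [ln] to be inverted by [expR] on the product of pattern probabilities. *)
Lemma pattern_prob_pos : {ae P, forall x, 0 < pattern_prob x}.
Proof.
have mZ := measurable_pattern_tuple act_meas X_meas (A := M).
have m0 : measurable [set x | pattern_prob x <= 0].
  by apply: measurable_le_set; have [] := pattern_prob_bmf.
have : {ae P, forall x, ~ [set x | pattern_prob x <= 0] x}.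
  apply: prob0_ae => //; rewrite fineP_EFin // -(fineP_partition P mZ m0).
  rewrite big1 // => w _.
  have [w0|w0] := leP (pattern_weight w) 0.
    apply/eqP; rewrite eq_le fineP_ge0 andbT (le_trans _ w0) //; apply: le_fineP.
    - exact: measurableI.
    - exact: measurable_pattern.
    - by move=> x [_ /= <-].
  rewrite (_ : _ `&` _ = set0) ?measure0 //; apply/seteqP; split => // x /= [h E].
  by move: h; rewrite /pattern_prob E leNgt w0.
by apply: filterS => x /= /negP; rewrite -ltNge.
Qed.

End Coding.

(** * The recurrence rate *)

Section Estimates.
Variable R : realType.

(** Square [1 + eta * s / 2 <= expR (eta * s / 2)]. This absorbs the factor [size (F k) ^ 2] lost in
    disjointification. *)
Lemma sqr_le_expR (eta s : R) : 0 < eta -> 0 <= s -> s ^+ 2 <= 4 / eta ^+ 2 * expR (eta * s).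
Proof.
move=> e0 s0; rewrite mulrAC ler_pdivlMr ?exprn_gt0 //.
have h := expR_ge1Dx (eta * s / 2).
have -> : expR (eta * s) = expR (eta * s / 2) ^+ 2 by rewrite expr2 -expRD; congr expR; field.
have es : 0 <= eta * s by rewrite mulr_ge0 // ltW.
set v := expR _ in h *; clearbody v; nra.
Qed.

Lemma limn_esup_le (u : nat -> \bar R) (l : \bar R) N :
  (forall n, (N <= n)%N -> (u n <= l)%E) -> (limn_esup u <= l)%E.
Proof.
move=> h; rewrite limn_esup_lim; apply: lime_le; first exact: is_cvg_esups.
exists N => // n /= Nn; apply: ub_ereal_sup => _ [k /= nk <-].
by apply: h; exact: leq_trans nk.
Qed.

End Estimates.

Section Main.
Variables (R : realType) (G : countType) (Gs : group_str G).
Variables (d : measure_display) (T : measurableType d) (P : probability T R).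
Variables (Sigma : finType) (act : G -> T -> T) (X : T -> Sigma).
Hypothesis act1 : forall x, act (gone Gs) x = x.
Hypothesis actM : forall g g' x, act (gmul Gs g g') x = act g (act g' x).
Hypothesis act_meas : forall g, measurable_fun setT (act g).
Hypothesis act_inv : forall g A, measurable A -> P (act g @^-1` A) = P A.
Hypothesis act_erg : forall A, measurable A -> (forall g, act g @^-1` A = A) ->
  P A = 0%E \/ P A = 1%E.
Hypothesis X_meas : forall s, measurable (X @^-1` [set s]).
Variables (F W : nat -> seq G) (h : R).
Hypothesis Ffol : folner Gs R F.
Hypothesis Ftemp : tempered Gs R F.

Let s k : R := (size (F k))%:R.
Let s0 k : 0 < s k.
Proof. by rewrite ltr0n; have [] := Ffol.1 k. Qed.

Lemma deficient_small (M : seq G) (eta : R) : uniq M -> 0 < eta ->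
  exists N, forall k, (N <= k)%N ->
  #|Sigma|%:R ^+ deficient Gs M (F k) <= expR (eta * s k).
Proof.
move=> uM e0.
have S0 : 0 < #|Sigma|%:R :> R by rewrite ltr0n; apply/card_gt0P; exists (X point).
pose L : R := ln #|Sigma|%:R.
have L0 : 0 <= L by rewrite ln_ge0 // ler1n -(ltr0n R).
have L1 : 0 < L + 1 by rewrite ltr_wpDl.
have [N hN] := folner_boundary M Ffol (divr_gt0 e0 L1).
exists N => k /hN hk.
rewrite -[X in X ^+ _](lnK S0) -expRM_natl ler_expR -/L.
have := deficient_le Gs (F k) uM; rewrite -(ler_nat R) => /le_trans /(_ hk) hd.
apply: (@le_trans _ _ (eta / (L + 1) * s k * L)); first by rewrite ler_wpM2r.
rewrite mulrAC ler_wpM2r ?(ltW (s0 k)) // mulrAC ler_pdivrMr // ler_wpM2l ?(ltW e0) //.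
by rewrite lerDl.
Qed.

(** The product defining [good] is the exponential of minus [size (F k) / m] times the ergodic
    average of the information function of the window [F m0]. That average eventually exceeds its
    mean by at most [m * ln 2 * eps]. *)
Lemma ae_eventually_good (m0 : nat) (eps : R) : 0 < eps ->
  joint_entropy P act X (F m0) / s m0 <= h + eps ->
  {ae P, forall x, exists N, forall k, (N <= k)%N ->
     good P act X (F m0) (F k) (expR (- (s k * (ln 2 * (h + 2 * eps))))) x}.
Proof.
move=> e0 hm; pose M := F m0; pose m := s m0.
pose phi x : R := - ln (pattern_prob P act X M x).
have bphi : bmf phi.
  exact: (finite_valued_bmf (measurable_pattern_tuple act_meas X_meas (A := M))
    (fun w => - ln (pattern_weight P act X w))).
have l2 : 0 < ln 2 :> R by rewrite ln_gt0 // ltr1n.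
have Ephi : expect P phi <= m * (ln 2 * (h + eps)).
  rewrite (expect_pattern_information P act_meas X_meas) mulrCA.
  by rewrite ler_pM2l // mulrC -ler_pdivrMr //; exact: s0.
have pos : {ae P, forall x, forall g, 0 < pattern_prob P act X M (act g x)}.
  apply: ae_forall_count => g.
  exact: (ae_comp (act_meas g) (act_inv g) (pattern_prob_pos P act_meas X_meas M)).
have erg := pointwise_ergodic act1 actM act_meas act_inv Ffol Ftemp act_erg bphi.
apply: filterS2 pos erg => x pos hx.
have me0 : 0 < m * (ln 2 * eps) by rewrite !mulr_gt0 //; exact: s0.
have [N hN] := hx _ me0; exists N => k /hN.
rewrite ler_norml => /andP[_ hk]; rewrite /good /=.
have -> : \prod_(f <- F k) (pattern_prob P act X M (act f x) `^ (size M)%:R^-1) =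
    expR (- (m^-1 * \sum_(f <- F k) phi (act f x))).
  rewrite mulr_sumr -sumrN expR_sum; apply: eq_bigr => f _.
  rewrite /phi mulrN opprK mulrC expRM lnK //; exact: pos.
rewrite ler_expR lerN2 mulrC ler_pdivrMr; last exact: s0.
have : avg act F k phi x <= m * (ln 2 * (h + 2 * eps)) by lra.
by rewrite /avg ler_pdivrMr ?s0 // -/(s k) => hh; rewrite mulrC [s k * _]mulrC mulrA.
Qed.

Hypothesis Fcard : forall n, (n <= size (F n))%N.
Hypothesis hent : (fun k => joint_entropy P act X (F k) / (size (F k))%:R) @ \oo --> h.
Hypothesis Wfill : filling Gs R W.

Lemma ae_eventually_dense (eps : R) : 0 < eps ->
  {ae P, forall x, exists N, forall k, (N <= k)%N -> forall n,
     ~ sparse Gs act X (F k) (W n) (expR (- (s k * (ln 2 * (h + 5 * eps))))) x}.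
Proof.
move=> e0; have l2 : 0 < ln 2 :> R by rewrite ln_gt0 // ltr1n.
have [m0 hm0] : exists m0, joint_entropy P act X (F m0) / s m0 <= h + eps.
  have [N /(_ N (leqnn N))] := cvg_tends0 hent e0.
  by rewrite ler_norml => /andP[_ hh]; exists N; rewrite -lerBlDl.
pose M := F m0; have [uM M0] := Ffol.1 m0.
pose eta := ln 2 * eps; have eta0 : 0 < eta by rewrite mulr_gt0.
have [N0 hN0] := deficient_small uM eta0.
have [C fW] := Wfill; have [C0 _] := fW.
pose t k := expR (- (s k * (ln 2 * (h + 2 * eps)))).
(* Powers of 2 are written through [expR]. The gap between [2 * eps] in [t] and [5 * eps] in [delta]
   leaves three units of [eta * s k]: one for deficient sites, one for the square of [s k], and one
   for geometric decay, through [k <= s k]. *)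
pose delta k := expR (- (s k * (ln 2 * (h + 5 * eps)))).
pose B k := [set x | exists n, sparse Gs act X (F k) (W n) (delta k) x].
have msp k n : measurable (sparse Gs act X (F k) (W n) (delta k)).
  exact: measurable_sparse.
have mB k : measurable (B k).
  rewrite (_ : B k = \bigcup_n sparse Gs act X (F k) (W n) (delta k)).
    exact: bigcup_measurable.
  by apply/seteqP; split => x /= [n]; [exists n | move=> _ ?; exists n].
have mg k : measurable (good P act X M (F k) (t k)) by exact: measurable_good.
have mcyl k y : measurable (cylinder (fun v x => X (act v x)) (F k) y).
  by apply: measurable_cylinder => v a; exact: (measurable_symbol act_meas X_meas v a).
pose kap k : R := (size (F k) ^ 2)%:R * delta k / C.
have kap0 k : 0 <= kap k.
  by rewrite divr_ge0 ?mulr_ge0 ?expR_ge0 // ltW.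
have hcyl k y : fine (P (B k `&` cylinder (fun v x => X (act v x)) (F k) y)) <= kap k.
  pose BN N := [set x | exists2 n, (n < N)%N & sparse Gs act X (F k) (W n) (delta k) x] `&`
      cylinder (fun v x => X (act v x)) (F k) y.
  have -> : B k `&` cylinder (fun v x => X (act v x)) (F k) y = \bigcup_N BN N.
    apply/seteqP; split => x /=.
      by move=> [[n hn] hc]; exists n.+1 => //; split => //; exists n.
    by move=> [N _ [[n _ hn] hc]]; split => //; exists n.
  apply: fineP_bigcup.
  - move=> N; apply: measurableI => //.
    rewrite (_ : mkset _ = \bigcup_(n in `I_N) sparse Gs act X (F k) (W n) (delta k)).
      by apply: bigcup_measurable => n _.
    by apply/seteqP; split => x /= [n nN hn]; exists n.
  - move=> n m nm x [[j jn hj] hc]; split => //; exists j => //; exact: leq_trans nm.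
  - move=> N; apply: (sparse_cylinder actM act_meas act_inv X_meas Ffol) => //.
      by have [] := Ffol.1 k.
    exact: expR_ge0.
have hBg k : fine (P (B k `&` good P act X M (F k) (t k))) <=
    kap k / t k * #|Sigma|%:R ^+ deficient Gs M (F k).
  apply: (@good_bound R G Gs d T P Sigma act X actM act_meas X_meas M (B k) (F k)
    (t k) (kap k) (fun=> X point)) => //.
    by have [] := Ffol.1 k.
  exact: expR_gt0.
(* Borel-Cantelli asks for a bound at every [k], while the deficiency estimate starts at [N0];
   earlier events are emptied. *)
pose A k := if (N0 <= k)%N then B k `&` good P act X M (F k) (t k) else set0.
have bc : {ae P, forall x, exists N, forall k, (N <= k)%N -> ~ A k x}.
  apply: (@borel_cantelli_geometric _ _ _ P A (4 / eta ^+ 2 / C) (expR (- eta))).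
  - by move=> k; rewrite /A; case: ifP => _ //; exact: measurableI.
  - by rewrite !divr_ge0 ?exprn_ge0 // ltW.
  - by rewrite expR_ge0 expR_lt1 oppr_lt0.
  - move=> k; rewrite /A; case: ifPn => [Nk|_]; last first.
      by rewrite measure0 mulr_ge0 ?exprn_ge0 ?expR_ge0 // !divr_ge0 ?exprn_ge0 // ltW.
    apply: (le_trans (hBg k)).
    apply: (@le_trans _ _ (kap k / t k * expR (eta * s k))).
      by rewrite ler_wpM2l ?hN0 // divr_ge0 ?expR_ge0.
    have -> : kap k / t k * expR (eta * s k) = s k ^+ 2 * expR (- (eta * s k) *+ 2) / C.
      have -> : kap k / t k * expR (eta * s k) = s k ^+ 2 * (delta k / t k * expR (eta * s k)) / C.
        by rewrite /kap natrX; ring.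
      congr (_ * _ / _); rewrite /delta /t -expRN -!expRD; congr expR.
      by rewrite /eta; ring.
    rewrite [leRHS]mulrAC ler_pM2r ?invr_gt0 //.
    apply: (@le_trans _ _ (4 / eta ^+ 2 * expR (eta * s k) * expR (- (eta * s k) *+ 2))).
      by rewrite ler_wpM2r ?expR_ge0 //; apply: sqr_le_expR => //; exact: ltW.
    rewrite -mulrA -expRD ler_wpM2l ?divr_ge0 ?exprn_ge0 ?(ltW eta0) //.
    rewrite -expRM_natl ler_expR mulr2n.
    have : eta * k%:R <= eta * s k by rewrite ler_wpM2l ?(ltW eta0) // ler_nat.
    lra.
apply: filterS2 bc (ae_eventually_good e0 hm0) => x [N1 h1] [N2 h2].
exists (maxn N0 (maxn N1 N2)) => k; rewrite !geq_max => /and3P[k0 k1 k2] n hsp.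
apply: (h1 k k1); rewrite /A k0; split; first by exists n.
exact: h2.
Qed.

Lemma dense_rate (k n : nat) (x : T) (c : R) :
  ~ sparse Gs act X (F k) (W n) (expR (- (s k * (ln 2 * c)))) x ->
  - (log2 (U_kn Gs act X R F W k n x)) / s k <= c.
Proof.
move=> hs; have l2 : 0 < ln 2 :> R by rewrite ln_gt0 // ltr1n.
have [C [_ [uW _]]] := Wfill.
have W0 : 0 < (size (W n))%:R :> R.
  by have [_] := uW n; rewrite ltr0n; case: (W n).
have [m vm hm] : exists2 m : (size (W n)).-tuple bool,
    valid_E Gs act X (F k) (W n) x (mask m (W n)) &
    expR (- (s k * (ln 2 * c))) * (size (W n))%:R <= (size (mask m (W n)))%:R.
  apply: contrapT => hno; apply: hs => m vm; rewrite ltNge; apply/negP => hm.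
  by apply: hno; exists m.
set U := U_kn _ _ _ _ _ _ _ _ _.
have hU : expR (- (s k * (ln 2 * c))) <= U.
  rewrite /U /U_kn ler_pdivlMr //; apply: (le_trans hm); rewrite ler_nat.
  exact: (leq_bigmax_cond (F := fun m : (size (W n)).-tuple bool => size (mask m (W n)))).
rewrite ler_pdivrMr // lerNl /log2 ler_pdivlMr //.
have U0 : 0 < U by apply: lt_le_trans hU; exact: expR_gt0.
rewrite -ler_expR (lnK U0); apply: le_trans hU; rewrite ler_expR.
by rewrite le_eqVlt; apply/orP; left; apply/eqP; ring.
Qed.

Lemma recurrence_rate_le_entropy :
  {ae P, forall x,
     limn_esup (fun k => ereal_sup (range (fun n =>
        (- (log2 (U_kn Gs act X R F W k n x)) / (size (F k))%:R)%:E)))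
     <= h%:E}%E.
Proof.
(* Only countably many values of [eps] are used, so that a single null set serves them all. *)
have hj (j : nat) : {ae P, forall x, exists N, forall k, (N <= k)%N -> forall n,
     ~ sparse Gs act X (F k) (W n) (expR (- (s k * (ln 2 * (h + 5 * j.+1%:R^-1))))) x}.
  by apply: ae_eventually_dense; rewrite invr_gt0.
apply: filterS (ae_foralln hj) => x hx.
apply/lee_addgt0Pr => e e0.
have e50 : 0 < e / 5 by rewrite divr_gt0.
have [j hje] := exists_inv_lt e50.
have [N hN] := hx j.
apply: (@limn_esup_le _ _ _ N) => k Nk; apply: ub_ereal_sup => _ [n _ <-].
rewrite -EFinD lee_fin; apply: (le_trans (dense_rate (hN k Nk n))).
by rewrite lerD2l mulrC -ler_pdivlMr // ltW.
Qed.

End Main.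

Theorem theorem1p8 (R : realType) (G : countType) (Gs : group_str G)
  (d : measure_display) (T : measurableType d) (P : probability T R)
  (Sigma : finType) (act : G -> T -> T) (X : T -> Sigma)
  (F W : nat -> seq G) (h : R) :
  standard_borel R T ->
  (forall x, act (gone Gs) x = x) ->
  (forall g g' x, act (gmul Gs g g') x = act g (act g' x)) ->
  (forall g, measurable_fun setT (act g)) ->
  (forall g A, measurable A -> P (act g @^-1` A) = P A) ->
  (forall g x, act g x = x -> g = gone Gs) ->
  (forall A, measurable A -> (forall g, act g @^-1` A = A) -> P A = 0%E \/ P A = 1%E) ->
  (forall s, measurable (X @^-1` [set s])) ->
  folner Gs R F -> tempered Gs R F -> (forall n, (n <= size (F n))%N) ->
  (fun k => joint_entropy P act X (F k) / (size (F k))%:R) @ \oo --> h ->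
  filling Gs R W ->
  {ae P, forall x,
     limn_esup (fun k => ereal_sup (range (fun n =>
        (- (log2 (U_kn Gs act X R F W k n x)) / (size (F k))%:R)%:E)))
     <= h%:E}%E.
Proof.
move=> _ act1 actM act_meas act_inv _ act_erg X_meas Ffol Ftemp Fcard hent Wfill.
exact: (recurrence_rate_le_entropy act1 actM act_meas act_inv act_erg X_meas
  Ffol Ftemp Fcard hent Wfill).
Qed.
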